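(* Let $\mathcal{G}$ and $\mathcal{H}$ be ancestral graphs on the same node set $[p]$, and let $\mathcal{I}$ be a collection of intervention targets such that no selection adjacent node is doubly-intervened by $\mathcal{I}$ in either $\mathcal{G}$ or $\mathcal{H}$. The following are equivalent: 1. $\mathcal{G}$ and $\mathcal{H}$ are $\mathcal{I}$-Markov equivalent. 2. $\overline{\mathcal{G}}$ and $\overline{\mathcal{H}}$ are $\mathcal{I}$-Markov equivalent. 3. $\overline{\mathcal{G}}$ and $\overline{\mathcal{H}}$ are Markov equivalent, and $\overline{\mathcal{G}}^{\mathcal{I}}$ and $\overline{\mathcal{H}}^{\mathcal{I}}$ have the same $\mathcal{I}$-colliders with order.
   Context: Write $[p]=\{1,\dots,p\}$. A mixed graph $\mathcal{G}=([p],E)$ has edges that may be undirected ($i-j$), bidirected ($i\leftrightarrow j$) or directed ($i\to j$); it is a loopless mixed graph (LMG) if no edge has both endpoints equal. Two nodes are adjacent if they are the endpoints of some edge. A path is a sequence of distinct nodes with consecutive nodes joined by (specified) edges. A path is directed if all its edges are of the form $v_k\to v_{k+1}$; $j$ is an ancestor of $i$ (and $i$ a descendant of $j$) if there is a directed path from $j$ to $i$ (paths of length zero allowed); $\mathrm{an}_{\mathcal{G}}(C)$ is the set of ancestors of nodes in $C$. A three-node path $\langle v_1,v_2,v_3\rangle$ is a collider (path) if both its edges have arrowheads at $v_2$; it is a v-structure if moreover $v_1,v_3$ are not adjacent. A non-endpoint node of a longer path is a collider on it if the corresponding three-node subpath is a collider. m-separation: a path is m-connecting given $C$ if every collider subpath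 $\langle v_1,v_2,v_3\rangle$ of it has $v_2\in C\cup\mathrm{an}_{\mathcal{G}}(C)$ and all nodes of the path that are not the middle node of a collider subpath are not in $C$. For disjoint node sets $A,B,C$, $C$ m-separates $A$ and $B$ if no path between a node of $A$ and a node of $B$ is m-connecting given $C$. $\mathcal{J}(\mathcal{G})$ is the set of triples $\langle A,B\mid C\rangle$ such that $A$ and $B$ are m-separated given $C$ in $\mathcal{G}$. Two LMGs are Markov equivalent if $\mathcal{J}(\mathcal{G})=\mathcal{J}(\mathcal{H})$. Ancestral graph (AG): an LMG such that (i) there are no directed cycles; (ii) if $i\leftrightarrow j$ is an edge there is no directed path from $i$ to $j$ or from $j$ to $i$; (iii) if $i-j$ is an edge then no edge has an arrowhead at $i$ or at $j$. A selection adjacent node is an endpoint of an undirected edge. An LMG is maximal if adding any edge (between nonadjacent nodes) changes $\mathcal{J}(\mathcal{G})$. Every AG $\mathcal{G}$ is contained in a unique Markov equivalent maximal ancestral graph $\overline{\mathcal{G}}$, obtained from $\mathcal{G}$ by adding bidirected edges between nonadjacent endpoints of inducing paths, i.e. paths on which each non-endpoint node is both a collider on the path and an ancestor of at least one of the endpoints. Interventions: a collection of intervention targets $\mathcal{I}$ is a (finite) multiset of subsets of $[p]$. $\mathcal{I}$ doubly-intervenes on $i\in[p]$ if there are two distinct elements $I,J$ of the multiset $\mathcal{I}$ with $i\in I\cap J$. For an LMG $\mathcal{G}=([p],E)$, $\mathcal{G}^{\mathcal{I}}$ is the graph with nodes $[p]\cup W_{\mathcal{I}}$, $W_{\mathcal{I}}=\{\omega_I: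 I\in\mathcal{I}\setminus\{\emptyset\}\}$ (one new node per element of the multiset), and edges $E\cup\{\omega_I\to i: i\in I,\ I\in\mathcal{I}\setminus\{\emptyset\}\}$. $\overline{\mathcal{G}}^{\mathcal{I}}$ means $(\overline{\mathcal{G}})^{\mathcal{I}}$. Two LMGs $\mathcal{G},\mathcal{H}$ on $[p]$ are $\mathcal{I}$-Markov equivalent if $\mathcal{J}(\mathcal{G}^{\mathcal{I}})=\mathcal{J}(\mathcal{H}^{\mathcal{I}})$. Colliders with order: a path $\langle v_0,v_1,\dots,v_m,b,c\rangle$ is a discriminating path for $\langle v_m,b,c\rangle$ if $v_0$ and $c$ are nonadjacent and each of $v_1,\dots,v_m$ is a collider on the path and a parent of $c$ (i.e. $v_k\to c$ is an edge). Triples of order $t$ (the set $\mathfrak{D}_t$) in an LMG are three-node paths defined recursively: $\langle i,j,k\rangle\in\mathfrak{D}_0$ if $i$ and $k$ are not adjacent; $\langle i,j,k\rangle\in\mathfrak{D}_{t+1}$ if it is not in $\mathfrak{D}_s$ for any $s<t+1$ and there is a discriminating path $\langle v_0,\dots,v_m,b,c\rangle$ with $\langle i,j,k\rangle=\langle v_m,b,c\rangle$ or $\langle k,j,i\rangle=\langle v_m,b,c\rangle$ and $\langle v_0,v_1,v_2\rangle,\langle v_1,v_2,v_3\rangle,\dots,\langle v_{m-1},v_m,b\rangle\in\bigcup_{s\le t}\mathfrak{D}_s$. A collider with order is a collider path $\langle i,j,k\rangle$ that is a triple of order $t$ for some $t\ge 0$. An $\mathcal{I}$-collider with order in $\mathcal{G}^{\mathcal{I}}$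 is a collider with order in $\mathcal{G}^{\mathcal{I}}$ that is not a collider with order in $\mathcal{G}$. *)

(* Defs.v *)
From mathcomp Require Import all_boot.
From mathcomp Require Import boolp.

Set Implicit Arguments.
Unset Strict Implicit.
Unset Printing Implicit Defensive.

(* Parallel edges of different kinds are allowed; [dir x y] is x -> y. *)
Record lmg (V : finType) := LMG {
  und : rel V;
  bid : rel V;
  dir : rel V;
  und_sym : symmetric und;
  bid_sym : symmetric bid;
  und_irr : irreflexive und;
  bid_irr : irreflexive bid;
  dir_irr : irreflexive dir
}.

Section Graph.
Variables (V : finType) (G : lmg V).

Definition adjacent (x y : V) : bool :=
  [|| und G x y, bid G x y, dir G x y | dir G y x].

(* [connect] only asks for a directed walk, but a walk always shortens to a
   path with distinct nodes. *)
Definition ancestor (j i : V) : bool := connect (dir G) j i.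

Definition an (C : {set V}) : {set V} := [set j | [exists i in C, ancestor j i]].

Definition ancestral : Prop :=
  [/\ forall c : seq V, c != [::] -> ~~ cycle (dir G) c,
      forall i j, bid G i j -> ~~ ancestor i j /\ ~~ ancestor j i
    & forall i j, und G i j ->
        forall k, [/\ ~~ dir G k i, ~~ bid G k i, ~~ dir G k j & ~~ bid G k j]].

Definition selection_adjacent (i : V) : bool := [exists j, und G i j].

(* The two marks of an edge traversed from x to y: [m.1] (resp. [m.2]) says
   whether the edge has an arrowhead at x (resp. y). *)
Definition marks : Type := (bool * bool)%type.

Definition edge (m : marks) (x y : V) : bool :=
  match m with
  | (false, false) => und G x y
  | (true, true) => bid G x y
  | (false, true) => dir G x y
  | (true, false) => dir G y x
  end.

(* A path with specified edges is its first node x and the sequence s of its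
   steps (edge, next node). *)
Definition nodes (x : V) (s : seq (marks * V)) : seq V := x :: unzip2 s.

Definition endpoint (x : V) (s : seq (marks * V)) : V := last x (unzip2 s).

Fixpoint joined (x : V) (s : seq (marks * V)) : bool :=
  if s is (m, y) :: s' then edge m x y && joined y s' else true.

Definition is_path (x : V) (s : seq (marks * V)) : bool :=
  uniq (nodes x s) && joined x s.

(* <x, y, z> with the marks of its two edges. *)
Definition triple : Type := (V * marks * V * marks * V)%type.

Definition mid (T : triple) : V := let: (_, _, y, _, _) := T in y.

Definition three_path (T : triple) : bool :=
  let: (x, m, y, n, z) := T in is_path x [:: (m, y); (n, z)].

Definition rev_triple (T : triple) : triple :=
  let: (x, m, y, n, z) := T in (z, (n.2, n.1), y, (m.2, m.1), x).

Definition collider (T : triple) : bool :=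
  let: (_, m, _, n, _) := T in m.2 && n.1.

(* The three-node subpaths of a path, in order. *)
Fixpoint triples (x : V) (s : seq (marks * V)) : seq triple :=
  if s is (m, y) :: s1 then
    if s1 is (n, z) :: _ then (x, m, y, n, z) :: triples y s1 else [::]
  else [::].

Definition m_connecting (C : {set V}) (x : V) (s : seq (marks * V)) : Prop :=
  [/\ is_path x s,
      forall T, T \in triples x s -> collider T -> mid T \in C :|: an C
    & forall v, v \in nodes x s ->
        ~ (exists T, [/\ T \in triples x s, collider T & mid T = v]) ->
        v \notin C].

Definition m_separated (A B C : {set V}) : Prop :=
  forall x s, x \in A -> endpoint x s \in B -> ~ m_connecting C x s.

Definition indep_model (A B C : {set V}) : Prop :=
  [/\ [disjoint A & B], [disjoint A & C], [disjoint B & C]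
    & m_separated A B C].

Definition inducing (x : V) (s : seq (marks * V)) : bool :=
  is_path x s &&
  all (fun T => collider T &&
         (ancestor (mid T) x || ancestor (mid T) (endpoint x s)))
      (triples x s).

Definition inducing_nonadjacent (x y : V) : bool :=
  [&& x != y, ~~ adjacent x y & `[< exists2 s, inducing x s & endpoint x s = y >]].

(* [discriminating x ts T s]: the path (x, s) = <v_0, ..., v_m, b, c>, with
   m >= 1, is discriminating for T = <v_m, b, c>, and ts lists
   <v_0, v_1, v_2>, ..., <v_(m-1), v_m, b>. *)
Definition discriminating (x : V) (s : seq (marks * V))
    (ts : seq triple) (T : triple) : bool :=
  let c := endpoint x s in
  [&& is_path x s, triples x s == rcons ts T, ts != [::], ~~ adjacent x c
    & all (fun T' => collider T' && dir G (mid T') c) ts].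

Definition order_zero (T : triple) : Prop :=
  three_path T /\ let: (x, _, _, _, z) := T in ~~ adjacent x z.

Definition order_next (D : triple -> Prop) (T : triple) : Prop :=
  [/\ three_path T, ~ D T
    & exists x s ts T',
        [/\ discriminating x s ts T', T = T' \/ rev_triple T = T'
          & forall T'', T'' \in ts -> D T'']].

(* The union of the D_s for s <= t. *)
Fixpoint order_upto (t : nat) (T : triple) : Prop :=
  if t is t'.+1 then order_upto t' T \/ order_next (order_upto t') T
  else order_zero T.

(* Membership in D_t: [order_next] excludes the triples of lower order. *)
Definition has_order (t : nat) (T : triple) : Prop :=
  if t is t'.+1 then order_next (order_upto t') T else order_zero T.

(* Identified with its three nodes: an ancestral graph has at most one edge
   between two nodes, so they determine the edges. *)
Definition collider_with_order (x y z : V) : Prop :=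
  exists m n, collider (x, m, y, n, z) /\
    exists t, has_order t (x, m, y, n, z).

End Graph.

Definition markov_equiv (V : finType) (G H : lmg V) : Prop :=
  forall A B C : {set V}, indep_model G A B C <-> indep_model H A B C.

Section Completion.
Variables (V : finType) (G : lmg V).

Definition completion_bid : rel V := fun x y =>
  [|| bid G x y, inducing_nonadjacent G x y | inducing_nonadjacent G y x].

Fact completion_bid_sym : symmetric completion_bid.
Proof. by move=> x y; rewrite /completion_bid bid_sym [X in _ || X]orbC. Qed.

Fact completion_bid_irr : irreflexive completion_bid.
Proof.
by move=> x; rewrite /completion_bid bid_irr /inducing_nonadjacent eqxx.
Qed.

(* When G is ancestral, this is the unique maximal ancestral graph that
   contains G and is Markov equivalent to it. *)
Definition completion : lmg V :=
  LMG (@und_sym V G) completion_bid_sym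
      (@und_irr V G) completion_bid_irr (@dir_irr V G).

End Completion.

(* A finite multiset of targets is a family indexed by 'I_m; its elements are
   the indices, so that equal targets with distinct indices stay distinct. *)
Section Intervention.
Variables (p m : nat) (I : 'I_m -> {set 'I_p}).

Definition doubly_intervenes (i : 'I_p) : Prop :=
  exists k l : 'I_m, k != l /\ i \in I k :&: I l.

Definition omega : finType := {k : 'I_m | I k != set0}.

Definition inode : finType := ('I_p + omega)%type.

Variable G : lmg 'I_p.

Definition aug_und : rel inode := fun x y =>
  match x, y with inl i, inl j => und G i j | _, _ => false end.

Definition aug_bid : rel inode := fun x y =>
  match x, y with inl i, inl j => bid G i j | _, _ => false end.

Definition aug_dir : rel inode := fun x y =>
  match x, y with
  | inl i, inl j => dir G i j
  | inr w, inl i => i \in I (val w)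
  | _, inr _ => false
  end.

Fact aug_und_sym : symmetric aug_und.
Proof. by move=> [i|w] [j|w'] //=; rewrite und_sym. Qed.

Fact aug_bid_sym : symmetric aug_bid.
Proof. by move=> [i|w] [j|w'] //=; rewrite bid_sym. Qed.

Fact aug_und_irr : irreflexive aug_und.
Proof. by move=> [i|w] //=; rewrite und_irr. Qed.

Fact aug_bid_irr : irreflexive aug_bid.
Proof. by move=> [i|w] //=; rewrite bid_irr. Qed.

Fact aug_dir_irr : irreflexive aug_dir.
Proof. by move=> [i|w] //=; rewrite dir_irr. Qed.

Definition aug : lmg inode :=
  LMG aug_und_sym aug_bid_sym aug_und_irr aug_bid_irr aug_dir_irr.

Definition I_collider_with_order (x y z : inode) : Prop :=
  collider_with_order aug x y z /\
  ~ (exists i j k, [/\ x = inl i, y = inl j, z = inl k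
                     & collider_with_order G i j k]).

End Intervention.

Definition I_markov_equiv (p m : nat) (I : 'I_m -> {set 'I_p})
    (G H : lmg 'I_p) : Prop :=
  markov_equiv (aug I G) (aug I H).

(* Main.v *)
Require Import Defs.
From mathcomp Require Import all_boot zify.
From mathcomp Require Import boolp.

(** Both equivalences come from a criterion for a class of graphs slightly wider
than the ancestral ones. An intervention node may put an arrowhead on a node
[i] that has an undirected edge, so an augmented graph need not be ancestral.
But when [i] is not doubly intervened this is the only arrowhead at [i], and
its origin has neither arrowheads nor undirected edges. In the resulting class
([quasi_ancestral]) a node with an undirected edge is still never a collider
on a path, which is what the usual arguments on ancestral graphs use.

The criterion is that two maximal graphs of the class are Markov equivalent
iff they have the same adjacencies and the same colliders with order.

Necessity ([markov_eq_adj], [markov_colliders]). In a maximal graph any two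
nonadjacent nodes are separated by some set ([separated]), so adjacency is
visible in the independence model. On a discriminating path
[v_0, ..., v_m, b, c], a set that separates [v_0] from [c] must contain the
[v_k], and contains [b] iff [b] is not a collider ([disc_sep]). Induction along
discriminating paths then carries every triple with order, and its status, to
the other graph ([ordered_transfer]).

Sufficiency ([colliders_markov]). Take a connecting walk of minimal total
weight, where the weight of a node is the number of its descendants. Whenever
a triple on it is shielded, the attempt to bypass its middle node leads back
along a discriminating path ([discriminate_or_bypass]), so every triple has an
order ([min_walk_ordered]) and keeps its status in the other graph. A collider
[b] stays an ancestor of the conditioning set: with [d] the next node on a
shortest directed path from [b] to that set, the walk cannot be rerouted
through [d], because [d] weighs less than [b], and what prevents this is again
a discriminating path, which forces [b -> d] in the other graph
([collider_transfer]).

For the first equivalence, each bidirected edge of the completion is simulated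
by the inducing path behind it ([simulate]), also in the presence of
intervention nodes. For the second, the criterion is applied to the completions
and to their augmented graphs. Conditioning on all intervention nodes recovers
the independence model of the original graph ([aug_markov_plain]), and a
collider with order of the original graph remains one after augmentation
([ordered_aug]), so those of the augmented graph are exactly these together
with the I-colliders. *)

Set Implicit Arguments.
Unset Strict Implicit.
Unset Printing Implicit Defensive.

(** * Arrowheads and quasi-ancestral graphs *)

Section Graph.
Variables (V : finType) (G : lmg V).

Definition arr x y := bid G x y || dir G x y.

Definition source z := [forall u, ~~ und G z u && ~~ arr u z].

Definition collides x y z := arr x y && arr z y.

(** The part of ancestrality that survives interventions: an arrowhead may
    meet an undirected edge, but only one, and only coming from a source.
    Hence nodes with an undirected edge are never colliders on a path. *)
Record quasi_ancestral : Prop := QuasiAncestral {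
  qa_dir : forall x y, dir G x y -> ~~ ancestor G y x;
  qa_bid : forall x y, bid G x y -> ~~ ancestor G x y;
  qa_und : forall x y z, und G x y -> arr z x -> source z;
  qa_uniq : forall x y z z', und G x y -> arr z x -> arr z' x -> z = z'
}.

Lemma adj_sym x y : adjacent G x y = adjacent G y x.
Proof. by rewrite /adjacent und_sym bid_sym [dir G x y || _]orbC. Qed.

Lemma adj_irr x : adjacent G x x = false.
Proof. by rewrite /adjacent und_irr bid_irr dir_irr. Qed.

Lemma arr_adj x y : arr x y -> adjacent G x y.
Proof. by rewrite /arr /adjacent => /orP[]->; rewrite !orbT. Qed.

Lemma dir_arr x y : dir G x y -> arr x y.
Proof. by rewrite /arr => ->; rewrite orbT. Qed.

Lemma arr_source x y : arr x y -> ~~ source y.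
Proof. by move=> h; apply/negP => /forallP/(_ x); rewrite h andbF. Qed.

Lemma tail_und_or_dir x y :
  adjacent G x y -> ~~ arr y x -> und G x y || dir G x y.
Proof.
rewrite /adjacent /arr bid_sym; case: (und G x y) => //=.
by case: (bid G y x) => //=; case: (dir G y x); rewrite ?orbF.
Qed.

Lemma anc_refl x : ancestor G x x.
Proof. exact: connect0. Qed.

Lemma anc_trans y x z : ancestor G x y -> ancestor G y z -> ancestor G x z.
Proof. exact: connect_trans. Qed.

Lemma dir_anc x y : dir G x y -> ancestor G x y.
Proof. exact: connect1. Qed.

Lemma mem_an (C : {set V}) v :
  reflect (exists2 c, c \in C & ancestor G v c) (v \in an G C).
Proof. by rewrite inE; exact: exists_inP. Qed.

Lemma sub_an (C : {set V}) v : v \in C -> v \in an G C.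
Proof. by move=> vC; apply/mem_an; exists v => //; exact: anc_refl. Qed.

Lemma anc_an (C : {set V}) u v : ancestor G u v -> v \in an G C -> u \in an G C.
Proof.
by move=> uv /mem_an[c cC vc]; apply/mem_an; exists c => //; exact: anc_trans vc.
Qed.

Hypothesis qaG : quasi_ancestral.

Lemma arr_anc x y : arr y x -> ~~ ancestor G x y.
Proof.
by case/orP=> [|/(qa_dir qaG)//]; rewrite bid_sym => /(qa_bid qaG).
Qed.

Lemma und_arrF x y : und G x y -> arr y x = false.
Proof.
move=> xy; apply/negP => yx; have /forallP/(_ x) := qa_und qaG xy yx.
by rewrite und_sym xy.
Qed.

Lemma tail_dir x y : arr x y -> ~~ arr y x -> dir G x y.
Proof.
by rewrite /arr bid_sym => /orP[->//|->].
Qed.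

Lemma dir_tail x y : dir G x y -> arr y x = false.
Proof. by move=> xy; apply/negP=> /arr_anc; rewrite dir_anc. Qed.

(** An arrowhead that does not come from a source excludes undirected edges;
    this turns tails into directed edges throughout. *)
Lemma no_und z x y : arr z x -> ~~ source z -> und G x y = false.
Proof. by move=> zx; apply: contraNF => /(qa_und qaG)/(_ zx). Qed.

Lemma col_no_und x y z w : collides x y z -> x != z -> und G y w = false.
Proof.
by case/andP=> xy zy; apply: contraNF => /(qa_uniq qaG)/(_ xy zy)/eqP.
Qed.

Lemma tail_dir2 z x y : arr z x -> ~~ source z ->
  adjacent G x y -> ~~ arr y x -> dir G x y.
Proof.
by move=> zx zs xy yx; have := tail_und_or_dir xy yx; rewrite (no_und _ zx zs).
Qed.

Lemma arr_neq x y : arr x y -> x != y.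
Proof. by apply: contraTneq => ->; rewrite /arr bid_irr dir_irr. Qed.

Lemma dir_neq x y : dir G x y -> x != y.
Proof. by move/dir_arr/arr_neq. Qed.

Lemma arr_dir_neq u a t : arr u a -> dir G a t -> u != t.
Proof.
by move=> ua at_; apply: contraTneq ua => ->; rewrite dir_tail.
Qed.

(** Otherwise the third edge would be directed from [t] to [u] and
    [a -> t -> u] would contradict the arrowhead at [a]. *)
Lemma triangle u a t : arr u a -> dir G a t -> adjacent G u t -> arr u t.
Proof.
move=> ua at_ ut; apply/contraT => nut.
have := tail_dir2 (dir_arr at_) (arr_source ua) (etrans (adj_sym _ _) ut) nut.
by move/dir_anc/(anc_trans (dir_anc at_)); rewrite (negPf (arr_anc ua)).
Qed.

Definition marks_of x y : marks := (arr y x, arr x y).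

(** There is at most one edge between two nodes, so walks can be given by
    their nodes alone. *)
Lemma edge_marks_of m x y : edge G m x y = adjacent G x y && (m == marks_of x y).
Proof.
have Hd := @dir_tail x y; have Hd' := @dir_tail y x.
have Hu := @und_arrF x y; have Hu' := @und_arrF y x.
move: Hd Hd' Hu Hu'; rewrite /marks_of /adjacent /arr [bid G y x]bid_sym [und G y x]und_sym.
have: bid G x y -> dir G x y = false.
  by move/(qa_bid qaG) => h; apply: contraNF h; exact: dir_anc.
have: bid G x y -> dir G y x = false.
  rewrite bid_sym => /(qa_bid qaG) => h; apply: contraNF h; exact: dir_anc.
case: m => [] [] [] /=.
all: case: (und G x y); case: (bid G x y); case: (dir G x y);
  case: (dir G y x) => //= h1 h2 h3 h4 h5 h6.
all: by first [by have := h1 isT | by have := h2 isT | by have := h3 isT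
             | by have := h4 isT | by have := h5 isT | by have := h6 isT].
Qed.

End Graph.

(** * Open walks *)

Section Reach.
Variables (V : finType) (G : lmg V) (C : {set V}).

(** The booleans are the marks at [v] of the two edges of a walk around [v]. *)
Definition pass v (s t : bool) := if s && t then v \in an G C else v \notin C.

(** Strictly decreasing along directed edges and positive: minimizing the sum
    over a walk both shortens the walk and moves its colliders towards the
    conditioning set. *)
Definition weight v := #|[set w | ancestor G v w]|.

Lemma weight_gt0 v : 0 < weight v.
Proof. by apply/card_gt0P; exists v; rewrite inE anc_refl. Qed.

Lemma weight_dir (qaG : quasi_ancestral G) u v : dir G u v -> weight v < weight u.
Proof.
move=> uv; apply/proper_card/properP; split.
  by apply/subsetP=> w; rewrite !inE; apply: anc_trans; exact: dir_anc.
by exists u; rewrite inE ?anc_refl // (qa_dir qaG).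
Qed.

(** In [reachw x u t q] an open walk from [x] to [u] may be continued by an edge
    with mark [t] at [u], and [q] is the weight of all its nodes but the last.
    A walk that stops at [u] is one that could leave by a tail, since then [u]
    has to lie outside [C]. *)
Inductive reachw x : V -> bool -> nat -> Prop :=
| reachw0 t : x \notin C -> reachw x x t 0
| reachwS u v t q : reachw x u (arr G v u) q -> adjacent G u v ->
    pass v (arr G u v) t -> reachw x v t (q + weight u).

Definition reach x u t := exists q, reachw x u t q.

Definition connecting x y := reach x y false.

Lemma reach0 x t : x \notin C -> reach x x t.
Proof. by exists 0; constructor. Qed.

Lemma reachS x u v t : reach x u (arr G v u) -> adjacent G u v ->
    pass v (arr G u v) t -> reach x v t.
Proof. by move=> [q h] uv vt; exists (q + weight u); apply: reachwS h _ _. Qed.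

Definition open_walk (v : nat -> V) n :=
  [/\ forall k, k < n -> adjacent G (v k) (v k.+1),
      forall k, k.+1 < n -> pass (v k.+1) (arr G (v k) (v k.+1)) (arr G (v k.+2) (v k.+1)),
      v 0 \notin C & v n \notin C].

Lemma pass_sym v s t : pass v s t = pass v t s.
Proof. by rewrite /pass andbC. Qed.

Lemma open_rev v n : open_walk v n -> open_walk (fun k => v (n - k)) n.
Proof.
move=> [h1 h2 h3 h4]; split; rewrite ?subn0 ?subnn // => k kn.
  by rewrite adj_sym (_ : n - k = (n - k.+1).+1); [apply: h1 | ]; lia.
rewrite pass_sym (_ : n - k = (n - k.+2).+2); last lia.
by rewrite (_ : n - k.+1 = (n - k.+2).+1); [apply: h2 | ]; lia.
Qed.

Definition walk_weight (v : nat -> V) i j := \sum_(i <= k < j) weight (v k).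

Definition ok_from_left v k t := (k == 0) || pass (v k) (arr G (v k.-1) (v k)) t.
Definition ok_from_right v n k t := (k == n) || pass (v k) t (arr G (v k.+1) (v k)).

Lemma reach_prefix v n k t : open_walk v n -> k <= n ->
  ok_from_left v k t -> reachw (v 0) (v k) t (walk_weight v 0 k).
Proof.
move=> [h1 h2 h3 h4]; elim: k t => [|k IH] t kn.
  by move=> _; rewrite /walk_weight big_geq //; constructor.
rewrite /ok_from_left /= => pt; rewrite /walk_weight big_nat_recr //=.
apply: reachwS pt; last exact: h1.
apply: IH; first exact: ltnW.
by case: k kn => // k kn; exact: h2.
Qed.

(** Together with [reach_prefix] this allows a walk to be cut and reconnected
    without building the new sequence of nodes. *)
Lemma reach_suffix v n k t x q : open_walk v n -> k <= n ->
  adjacent G x (v k) -> ok_from_right v n k (arr G x (v k)) ->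
  reachw t x (arr G (v k) x) q ->
  reachw t (v n) false (q + weight x + walk_weight v k n).
Proof.
move=> [h1 h2 h3 h4] kn; move En: (n - k) => d; elim: d k x q kn En => [|d IH] k x q kn En.
  have -> : k = n by lia.
  move=> xv _ hx; rewrite /walk_weight big_geq // addn0.
  by apply: reachwS hx _ _ => //; rewrite /pass andbF.
move=> xv okv hx.
have kn' : k < n by lia.
rewrite /walk_weight big_ltn // addnA.
apply: IH => //; first lia.
- exact: h1.
- rewrite /ok_from_right; case: eqP => //= kn1; apply: h2; lia.
- apply: reachwS hx _ _ => //.
  by move: okv; rewrite /ok_from_right ltn_eqF.
Qed.

Lemma reachw_walk x y t q : reachw x y t q -> exists v n,
  [/\ v 0 = x, v n = y & [/\ forall k, k < n -> adjacent G (v k) (v k.+1),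
      forall k, k.+1 < n -> pass (v k.+1) (arr G (v k) (v k.+1)) (arr G (v k.+2) (v k.+1)),
      v 0 \notin C, ok_from_left v n t & q = walk_weight v 0 n]].
Proof.
elim=> [s xC|u w s {}q _ [v [n [v0 vn [h1 h2 h3 h4 h5]]]] uw pw].
  by exists (fun=> x), 0; split=> //; split=> //; rewrite /walk_weight big_geq.
exists (fun k => if k == n.+1 then w else v k), n.+1; rewrite eqxx; split=> //; split=> //.
- move=> k; rewrite ltnS eqSS leq_eqVlt => /predU1P[->|kn].
    by rewrite ltn_eqF // eqxx vn.
  by rewrite !ltn_eqF ?(ltnW kn) //; [exact: h1 | exact: leqW].
- move=> k; rewrite ltnS !eqSS leq_eqVlt => /predU1P[kn|kn].
    have -> : (k == n.+1) = false by lia.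
    have -> : (k == n) = false by lia.
    by rewrite kn eqxx vn; move: h4; rewrite /ok_from_left -kn /= kn vn.
  have -> : (k == n.+1) = false by lia.
  have -> : (k == n) = false by lia.
  have -> : (k.+1 == n) = false by lia.
  exact: h2.
- by rewrite /ok_from_left /= eqxx (_ : n == n.+1 = false) ?vn //; lia.
- rewrite /walk_weight big_nat_recr //= (_ : n == n.+1 = false) ?vn; last lia.
  congr (_ + _); rewrite h5 /walk_weight !big_nat; apply: eq_bigr => k kn.
  by rewrite (_ : k == n.+1 = false) //; lia.
Qed.

Definition min_walk v n := open_walk v n /\
  forall q, reachw (v 0) (v n) false q -> walk_weight v 0 n <= q.

Lemma open_walk_connecting v n : open_walk v n -> connecting (v 0) (v n).
Proof.
move=> h; exists (walk_weight v 0 n); apply: (reach_prefix h) => //.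
by case: h => _ _ _ h; rewrite /ok_from_left /pass andbF h orbT.
Qed.

Lemma connecting_min_walk x y : connecting x y ->
  exists v n, [/\ v 0 = x, v n = y & min_walk v n].
Proof.
case=> q; elim/ltn_ind: q => q IH hq.
have [[q' [lt hq']]|no] := pselect (exists q', q' < q /\ reachw x y false q').
  exact: IH hq'.
have [v [n [v0 vn [h1 h2 h3 h4 h5]]]] := reachw_walk hq.
exists v, n; split=> //; split.
  split=> //; move: h4; rewrite /ok_from_left /pass andbF; case: eqP => //= n0 _.
  by rewrite n0.
rewrite v0 vn -h5 => q' hq'; rewrite leqNgt; apply/negP => lt.
by apply: no; exists q'.
Qed.

Lemma walk_weight_cat v i j k : i <= j -> j <= k -> walk_weight v i k = walk_weight v i j + walk_weight v j k.
Proof. by move=> ij jk; rewrite /walk_weight (big_cat_nat ij jk). Qed.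

Lemma walk_weight_ge v i j k : i <= k -> k < j -> weight (v k) <= walk_weight v i j.
Proof.
move=> ik kj; rewrite (@walk_weight_cat v i k j) //; last exact: ltnW.
by rewrite {2}/walk_weight big_ltn //; lia.
Qed.

(** The stretch strictly between positions [l] and [r] is dropped at no cost,
    so a chord of a minimal walk has to break a status at one of its ends. *)
Lemma min_chord v n l r : min_walk v n -> l.+1 < r -> r <= n ->
  adjacent G (v l) (v r) -> ok_from_left v l (arr G (v r) (v l)) ->
  ok_from_right v n r (arr G (v l) (v r)) -> False.
Proof.
move=> [ov mv] lr rn lr_adj okl okr.
have ln : l <= n by lia.
have := reach_suffix ov rn lr_adj okr (reach_prefix ov ln okl).
move/mv; rewrite (@walk_weight_cat v 0 l.+1 n) //; last lia.
rewrite (@walk_weight_cat v l.+1 r n) //; last lia.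
rewrite {1}/walk_weight big_nat_recr //= -/(walk_weight v 0 l).
have : weight (v l.+1) <= walk_weight v l.+1 r by apply: walk_weight_ge.
have := weight_gt0 (v l.+1); lia.
Qed.

(** The same for a stretch containing a node heavier than the node [d] that
    would replace it. *)
Lemma min_detour v n l i r d : min_walk v n -> l < i < r -> r <= n ->
  weight d < weight (v i) ->
  adjacent G (v l) d -> adjacent G d (v r) ->
  ok_from_left v l (arr G d (v l)) -> pass d (arr G (v l) d) (arr G (v r) d) ->
  ok_from_right v n r (arr G d (v r)) -> False.
Proof.
move=> [ov mv] /andP[li ir] rn wd ld dr okl okd okr.
have ln : l <= n by lia.
have := reach_suffix ov rn dr okr (reachwS (reach_prefix ov ln okl) ld okd).
move/mv; rewrite (@walk_weight_cat v 0 l.+1 n) //; last lia.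
rewrite (@walk_weight_cat v l.+1 r n) //; try lia.
rewrite {1}/walk_weight big_nat_recr //= -/(walk_weight v 0 l).
have : weight (v i) <= walk_weight v l.+1 r by apply: walk_weight_ge.
lia.
Qed.

Lemma min_walk_rev v n : min_walk v n -> min_walk (fun k => v (n - k)) n.
Proof.
move=> [ov mv]; split; first exact: open_rev.
rewrite subn0 subnn => q /reachw_walk[w [m [w0 wm [h1 h2 h3 h4 h5]]]].
have vC : v 0 \notin C by case: ov.
have ow : open_walk w m by split=> //; rewrite wm.
have := reach_prefix (open_rev ow) (leqnn m) (t := false).
rewrite subn0 subnn w0 wm => /(_ _)/mv.
have rw u k : walk_weight u 0 k + weight (u k) = walk_weight (fun j => u (k - j)) 0 k + weight (u 0).
  have -> : walk_weight u 0 k + weight (u k) = \sum_(0 <= j < k.+1) weight (u j).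
    by rewrite big_nat_recr.
  rewrite big_nat_rev /= add0n big_nat_recr //= subnn; congr (_ + _).
have := rw w m; have := rw v n; rewrite w0 wm -h5.
move=> e1 e2 le; have {}le : walk_weight v 0 n <= walk_weight (fun k => w (m - k)) 0 m.
  by apply: le; rewrite /ok_from_left /pass andbF subnn w0; case: ov => _ _ _ ->; rewrite orbT.
lia.
Qed.

End Reach.

Section Minimal.
Variables (V : finType) (G : lmg V) (C : {set V}).
Hypothesis qaG : quasi_ancestral G.
Variables (v : nat -> V) (n : nat).
Hypothesis mv : min_walk G C v n.

Let ov : open_walk G C v n. Proof. by case: mv. Qed.
Let adjv k : k < n -> adjacent G (v k) (v k.+1). Proof. by case: ov => h _ _ _; exact: h. Qed.
Let passv k : k.+1 < n ->
  pass G C (v k.+1) (arr G (v k) (v k.+1)) (arr G (v k.+2) (v k.+1)).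
Proof. by case: ov => _ h _ _; exact: h. Qed.

(** A node entered by an arrow from a non-source and left by a tail continues
    a directed path. *)
Lemma follow_tail l r : ~~ source G (v l) -> und G (v l) (v l.+1) = false ->
   ~~ arr G (v l.+1) (v l) -> l < r -> r <= n ->
  v l \in an G C \/
  [/\ arr G (v r.-1) (v r), ~~ source G (v r.-1) & ancestor G (v l) (v r)].
Proof.
move=> sl ul tl; elim: r => // r IH lr rn.
move: lr; rewrite ltnS leq_eqVlt => /predU1P[e|lr].
  subst r; right => /=.
  have h : dir G (v l) (v l.+1).
    by have := tail_und_or_dir (adjv rn) tl; rewrite ul.
  by split; [exact: dir_arr | | exact: dir_anc].
have [|[ar sr anr]] := IH lr (ltnW rn); first by left.
case: r lr rn ar sr anr {IH} => // r lr rn /= ar sr anr.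
have := passv rn; rewrite /pass ar /=; case: ifP => [_ h|/negbT nar _].
  by left; exact: anc_an h.
have h : dir G (v r.+1) (v r.+2) := tail_dir2 qaG ar sr (adjv rn) nar.
right; split; [exact: dir_arr | exact: arr_source ar | ].
exact: anc_trans (dir_anc h).
Qed.

(** Away from its junction, cutting out a loop changes no status. *)
Lemma cut_loop l r : l < r -> r <= n -> v l = v r ->
  (0 < l -> r < n ->
   pass G C (v l) (arr G (v l.-1) (v l)) (arr G (v r.+1) (v l))) -> False.
Proof.
move=> lr rn e; case: (posnP l) => [l0|l0].
  move=> _; subst l; case: mv => _ mv'.
  have [en|rn'] := eqVneq r n.
    have /mv' : reachw G C (v 0) (v n) false 0.
      by rewrite -en -e; constructor; case: ov.
    have := @walk_weight_ge _ G v 0 n 0 isT; rewrite -en => /(_ lr).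
    have := weight_gt0 G (v 0); lia.
  have rn2 : r < n by lia.
  have := reach_suffix ov rn2 (adjv rn2) (q := 0) (t := v 0).
  rewrite -e => h.
  have /mv' : reachw G C (v 0) (v n) false (0 + weight G (v 0) + walk_weight G v r.+1 n).
    apply: h; last by constructor; case: ov.
    rewrite /ok_from_right; case: eqP => //= ne; rewrite e; apply: passv; lia.
  rewrite (@walk_weight_cat _ G v 0 1 n) //; last lia.
  rewrite (@walk_weight_cat _ G v 1 r.+1 n) //; try lia.
  rewrite /(walk_weight _ _ 0 1) big_nat1.
  have : weight G (v r) <= walk_weight G v 1 r.+1 by apply: walk_weight_ge.
  have := weight_gt0 G (v r); lia.
have [en _|rn' ok] := eqVneq r n.
  case: mv => _ mv'.
  have ln : l <= n by lia.
  have := reach_prefix ov ln (t := false).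
  rewrite e en => /(_ _)/mv'.
  have -> : ok_from_left G C v l false.
    by rewrite /ok_from_left /pass andbF e en; case: ov => _ _ _ ->; rewrite orbT.
  rewrite (@walk_weight_cat _ G v 0 l n) // => /(_ isT).
  have : weight G (v l) <= walk_weight G v l n by apply: walk_weight_ge; lia.
  have := weight_gt0 G (v l); lia.
have rn2 : r < n by lia.
apply: (min_chord mv (l := l) (r := r.+1)) => //.
- rewrite e; exact: adjv.
- by rewrite /ok_from_left ok ?orbT.
- rewrite /ok_from_right e; case: eqP => //= ne; apply: passv; lia.
Qed.

(** If the junction of a loop were a new collider, both ends of the loop at
    that node would be tails; following one of them leads to a collider, hence
    into [an C], or back to the node with an arrowhead. The case of an
    undirected edge at the junction reduces to a loop at a source, which is
    never a collider. *)
Lemma min_walk_inj l r : l < r -> r <= n -> v l != v r.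
Proof.
(* Loops at sources are cut first. *)
suff srcF l' r' : l' < r' -> r' <= n -> source G (v l') -> v l' <> v r'.
  move=> lr rn; apply/eqP => e.
  apply: (cut_loop lr rn e) => l0 rn'; rewrite /pass.
  have pl := passv (k := l.-1); rewrite prednK // in pl.
  have {}pl := pl (leq_trans lr rn).
  have pr := passv (k := r.-1); rewrite prednK ?(leq_ltn_trans _ lr) // in pr.
  have {}pr := pr rn'.
  case: ifP => [/andP[al ar]|/negbT]; last first.
    rewrite negb_and => /orP[h|h].
      by move: pl; rewrite /pass (negPf h).
    by move: pr; rewrite /pass -e (negPf h) andbF.
  move: pl; rewrite /pass al /=; case: ifP => // /negbT tl _.
  move: pr; rewrite /pass -e ar andbT; case: ifP => // /negbT tr _.
  have ul w : und G (v l) w = false.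
    apply/negP => uw.
    have zz := qa_uniq qaG uw al ar; have zs := qa_und qaG uw al.
    by apply: (srcF l.-1 r.+1) zs zz; lia.
  have [//|[ar' _ _]] := follow_tail (arr_source al) (ul _) tl lr rn.
  by move: tr; rewrite e ar'.
move=> lr rn /forallP s e; apply: (cut_loop lr rn e) => l0 rn'.
have pl := passv (k := l'.-1); rewrite prednK // in pl.
have {}pl := pl (leq_trans lr rn).
move: pl; rewrite /pass.
by move: (s (v l'.-1)) (s (v r'.+1)) => /andP[_ /negPf->].
Qed.

Lemma min_walk_inj_eq i j : i <= n -> j <= n -> (v i == v j) = (i == j).
Proof.
move=> hi hj; case: (ltngtP i j) => [lt|lt|->]; last exact: eqxx.
  exact/negbTE/min_walk_inj.
by rewrite eq_sym; exact/negbTE/min_walk_inj.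
Qed.

End Minimal.

(** * Open walks and m-connecting paths *)

Section Marked.
Variables (V : finType) (G : lmg V).
Hypothesis qaG : quasi_ancestral G.
#[local] Arguments edge : simpl never.

(** The marked form of the nodes [v i, ..., v (i + n)], without the first. *)
Definition marked_walk (v : nat -> V) i n : seq (marks * V) :=
  [seq (marks_of G (v k) (v k.+1), v k.+1) | k <- iota i n].

Definition triple_of x y z : triple V := (x, marks_of G x y, y, marks_of G y z, z).

Lemma unzip2_marked_walk v i n : unzip2 (marked_walk v i n) = [seq v k | k <- iota i.+1 n].
Proof. by elim: n i => //= n IH i; rewrite IH. Qed.

Lemma nodes_marked_walk v i n : nodes (v i) (marked_walk v i n) = [seq v k | k <- iota i n.+1].
Proof. by rewrite /nodes unzip2_marked_walk. Qed.

Lemma endpoint_marked_walk v i n : endpoint (v i) (marked_walk v i n) = v (i + n).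
Proof.
rewrite /endpoint unzip2_marked_walk; elim: n i => [|n IH] i /=; first by rewrite addn0.
by rewrite IH addSnnS.
Qed.

Lemma triples_marked_walk v i n :
  triples (v i) (marked_walk v i n.+1) = [seq triple_of (v k) (v k.+1) (v k.+2) | k <- iota i n].
Proof.
elim: n i => [|n IH] i; first by [].
by have /= -> := IH i.+1.
Qed.

Lemma mem_triples v n T :
  reflect (exists2 k, k.+1 < n & T = triple_of (v k) (v k.+1) (v k.+2))
          (T \in triples (v 0) (marked_walk v 0 n)).
Proof.
case: n => [|n]; first by constructor; case.
rewrite triples_marked_walk; apply: (iffP mapP) => [[k]|[k]].
  by rewrite mem_iota => kn ->; exists k.
by move=> kn ->; exists k => //; rewrite mem_iota.
Qed.

Lemma joined_marked_walk v i n : (forall k, i <= k < i + n -> adjacent G (v k) (v k.+1)) ->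
  joined G (v i) (marked_walk v i n).
Proof.
elim: n i => //= n IH i h; rewrite edge_marks_of // eqxx andbT h ?IH //; last lia.
by move=> k hk; apply: h; lia.
Qed.

Lemma is_path_marked_walk v n : (forall k, k < n -> adjacent G (v k) (v k.+1)) ->
  (forall i j, i <= n -> j <= n -> v i = v j -> i = j) ->
  is_path G (v 0) (marked_walk v 0 n).
Proof.
move=> av iv; rewrite /is_path joined_marked_walk // andbT nodes_marked_walk map_inj_in_uniq ?iota_uniq //.
by move=> i j; rewrite !mem_iota => hi hj; apply: iv; lia.
Qed.

Lemma is_pathE x s : is_path G x s -> exists v n,
  [/\ x = v 0, s = marked_walk v 0 n, forall k, k < n -> adjacent G (v k) (v k.+1)
    & forall i j, i <= n -> j <= n -> v i = v j -> i = j].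
Proof.
case/andP=> us js.
suff [v [n [xv sv av]]] : exists v n,
    [/\ x = v 0, s = marked_walk v 0 n & forall k, k < n -> adjacent G (v k) (v k.+1)].
  exists v, n; split=> // i j hi hj e; subst x s; move: us.
  rewrite nodes_marked_walk => /(uniqP (v 0))/(_ i j).
  rewrite !inE size_map size_iota !ltnS => /(_ hi hj).
  by rewrite !(nth_map 0) ?size_iota // !nth_iota //; apply.
elim: s x {us} js => [|[m y] s IH] x /=.
  by exists (fun=> x), 0.
case/andP; rewrite edge_marks_of // => /andP[xy /eqP-> /IH[v [n [yv -> av]]]].
exists (fun k => if k is k'.+1 then v k' else x), n.+1; split=> //.
  rewrite /marked_walk /= yv; congr (_ :: _).
  by rewrite (iotaDl 1 0) -map_comp.
by case=> [|k]; [rewrite -yv | exact: av].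
Qed.

Lemma m_connecting_conn C x s : m_connecting G C x s ->
  connecting G C x (endpoint x s).
Proof.
case=> /is_pathE[v [n [-> -> av iv]]] hc hn; rewrite endpoint_marked_walk.
apply: open_walk_connecting; split=> //.
- move=> k kn; rewrite /pass; case: ifP => h.
    have /hc/(_ h) : triple_of (v k) (v k.+1) (v k.+2) \in triples (v 0) (marked_walk v 0 n).
      by apply/mem_triples; exists k.
    by rewrite in_setU => /orP[/sub_an|].
  apply: hn.
    by rewrite nodes_marked_walk map_f // mem_iota; lia.
  case=> T [/mem_triples[j jn ->] cT /= e].
  have {}e : j.+1 = k.+1 by apply: iv => //; lia.
  by case: e cT => ->; rewrite /= h.
- apply: hn; first by rewrite nodes_marked_walk map_f // mem_iota.
  case=> T [/mem_triples[j jn ->] cT /= e].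
  by have := iv _ _ _ _ e; lia.
- apply: hn; first by rewrite nodes_marked_walk map_f // mem_iota; lia.
  case=> T [/mem_triples[j jn ->] cT /= e].
  by have := iv _ _ _ _ e; lia.
Qed.

Lemma conn_m_connecting C x y : connecting G C x y ->
  exists2 s, m_connecting G C x s & endpoint x s = y.
Proof.
case/connecting_min_walk=> v [n [<- <- mv]]; exists (marked_walk v 0 n); last by rewrite endpoint_marked_walk.
case: (mv) => -[av pv v0 vn] _.
split.
- apply: is_path_marked_walk => // i j hi hj /eqP.
  by rewrite (min_walk_inj_eq qaG mv) // => /eqP.
- move=> T /mem_triples[k kn ->] /= h.
  by have := pv _ kn; rewrite /pass [_ && _]h => hv; rewrite in_setU hv orbT.
- move=> u; rewrite nodes_marked_walk => /mapP[k]; rewrite mem_iota => /andP[_ kn] -> h.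
  case: k kn h => // k kn h.
  have [->//|ne] := eqVneq k.+1 n.
  have := pv k; rewrite /pass; case: ifP => [cT|_]; last by apply; lia.
  case: h; exists (triple_of (v k) (v k.+1) (v k.+2)); split=> //.
  by apply/mem_triples; exists k => //; lia.
Qed.

(** Minimal walks are paths, so m-separation by paths and by walks agree. *)
Lemma indep_conn A B D : indep_model G A B D <->
  [/\ [disjoint A & B], [disjoint A & D], [disjoint B & D]
    & forall x y, x \in A -> y \in B -> ~ connecting G D x y].
Proof.
split=> -[h1 h2 h3 h4]; split=> //.
  move=> x y xA yB /conn_m_connecting[s hs e].
  by apply: (h4 x s) => //; rewrite e.
by move=> x s xA yB /m_connecting_conn; exact: h4.
Qed.

End Marked.

(** * Triples with order *)

Section Order.
Variables (V : finType) (G : lmg V).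

(** The discriminating path [v 0, ..., v m, v m.+1, c] for its last triple. With
    [m = 0] it is an unshielded triple, so that triples of order zero need no
    separate treatment. *)
Record disc_path (v : nat -> V) m c : Prop := Disc {
  disc_adj : forall k, k <= m -> adjacent G (v k) (v k.+1);
  disc_last : adjacent G (v m.+1) c;
  disc_inj : forall i j, i <= m.+1 -> j <= m.+1 -> v i = v j -> i = j;
  disc_end : forall i, i <= m.+1 -> v i != c;
  disc_nadj : ~~ adjacent G (v 0) c;
  disc_col : forall k, k < m -> collides G (v k) (v k.+1) (v k.+2);
  disc_dir : forall k, k < m -> dir G (v k.+1) c
}.

(** Whether a triple has some order, regardless of which. *)
Inductive ordered : V -> V -> V -> Prop :=
| ordered_disc v m c : disc_path v m c ->
    (forall k, k < m -> ordered (v k) (v k.+1) (v k.+2)) ->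
    ordered (v m) (v m.+1) c
| ordered_sym x y z : ordered x y z -> ordered z y x.

Hypothesis qaG : quasi_ancestral G.
#[local] Arguments edge : simpl never.

Lemma three_pathP T : three_path G T <-> exists x y z,
  [/\ T = triple_of G x y z, adjacent G x y, adjacent G y z & x != z].
Proof.
split.
  case: T => [[[[x m] y] n] z] /(is_pathE qaG)[v [k [xv]]].
  case: k => [|[|[|//]]] // [-> -> -> ->] av iv.
  exists (v 0), (v 1), (v 2); rewrite xv; split=> //; try exact: av.
  by apply/eqP => /iv; move=> /(_ isT isT).
case=> x [y [z [-> xy yz xz]]].
have nz : y != z by apply: contraTneq yz => ->; rewrite adj_irr.
have nx : x != y by apply: contraTneq xy => ->; rewrite adj_irr.
rewrite /three_path /triple_of /is_path /= !inE negb_or nx xz nz /=.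
by rewrite !edge_marks_of // xy yz !eqxx.
Qed.

Lemma triple_of_inj x y z x' y' z' : triple_of G x y z = triple_of G x' y' z' ->
  [/\ x = x', y = y' & z = z'].
Proof. by case=> -> _ _ -> _ _ ->. Qed.

Lemma rev_triple_of x y z : rev_triple (triple_of G x y z) = triple_of G z y x.
Proof. by []. Qed.

Lemma three_path_rev T : three_path G T -> three_path G (rev_triple T).
Proof.
case/three_pathP=> x [y [z [-> xy yz xz]]]; apply/three_pathP.
by exists z, y, x; split=> //; rewrite 1?adj_sym // eq_sym.
Qed.

Lemma rev_tripleK : involutive (@rev_triple V).
Proof. by case=> [[[[x [m1 m2]] y] [n1 n2]] z]. Qed.

Lemma order_upto_rev t T : order_upto G t T -> order_upto G t (rev_triple T).
Proof.
elim: t T => [|t IH] T /=.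
  case=> tp p; split; first exact: three_path_rev.
  by move: p; case: T tp => [[[[x m] y] n] z] _; rewrite adj_sym.
case=> [/IH|[tp nT [x [s [ts [T' [dT TT' tsD]]]]]]]; first by left.
right; split; first exact: three_path_rev.
  by move/IH; rewrite rev_tripleK.
exists x, s, ts, T'; split=> //.
by case: TT' => h; [right; rewrite rev_tripleK | left].
Qed.

Lemma has_order_upto t T : has_order G t T -> order_upto G t T.
Proof. by case: t => //= t; right. Qed.

Lemma order_upto_has t T : order_upto G t T -> exists s, has_order G s T.
Proof.
elim: t => [|t IH] /=; first by exists 0.
by case=> [/IH//|h]; exists t.+1.
Qed.

Lemma order_upto_leq s t T : s <= t -> order_upto G s T -> order_upto G t T.
Proof.
elim: t => [|t IH]; first by rewrite leqn0 => /eqP->.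
by rewrite leq_eqVlt => /predU1P[->//|st] /(IH st); left.
Qed.

Lemma map_iota_rcons T (f : nat -> T) n :
  [seq f k | k <- iota 0 n.+1] = rcons [seq f k | k <- iota 0 n] (f n).
Proof. by rewrite -addn1 iotaD map_cat cats1. Qed.

Lemma order_upto_ordered t T : order_upto G t T ->
  exists x y z, T = triple_of G x y z /\ ordered x y z.
Proof.
elim: t T => [|t IH] T /=.
  case=> /three_pathP[x [y [z [-> xy yz xz]]]] /= nxz.
  exists x, y, z; split=> //.
  pose v k := if k is 0 then x else y.
  apply: (@ordered_disc v 0) => //; split=> //=.
  - by case.
  - have nx : x != y by apply: contraTneq xy => ->; rewrite adj_irr.
    by move=> [|[|?]] [|[|?]] //= _ _ e; rewrite e eqxx in nx.
  - have nz : y != z by apply: contraTneq yz => ->; rewrite adj_irr.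
    by case.
case=> [/IH//|[/three_pathP[x [y [z [-> xy yz xz]]]] _ [u [s [ts [T' [dT TT' tsD]]]]]]].
exists x, y, z; split=> //.
suff h x' y' z' : T' = triple_of G x' y' z' -> ordered x' y' z'.
  by case: TT' => e; [exact: h | apply: ordered_sym; apply: h].
case/and5P: dT => /(is_pathE qaG)[v [n [-> -> av iv]]] /eqP.
rewrite endpoint_marked_walk add0n; case: n av iv => [|n] av iv /eqP.
  by case: (ts).
rewrite triples_marked_walk; case: n av iv => [|n] av iv; first by case: (ts).
rewrite map_iota_rcons eqseq_rcons => /andP[/eqP ets /eqP<-] _ nadj hts /triple_of_inj[<- <- <-].
have hin k : k < n -> triple_of G (v k) (v k.+1) (v k.+2) \in ts.
  by move=> kn; rewrite -ets; apply/mapP; exists k => //; rewrite mem_iota.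
apply: ordered_disc.
  split=> //.
  - by move=> k kn; apply: av; lia.
  - exact: av.
  - by move=> i j hi hj; apply: iv; lia.
  - by move=> i hi; apply/eqP => /iv; lia.
  - by move=> k /hin/(allP hts)/andP[].
  - by move=> k /hin/(allP hts)/andP[].
by move=> k /hin/tsD/IH[x'' [y'' [z'' [/triple_of_inj[-> -> ->]]]]].
Qed.

Lemma bounded_choice (P : nat -> nat -> Prop) m :
  (forall k s t, s <= t -> P k s -> P k t) ->
  (forall k, k < m -> exists t, P k t) -> exists t, forall k, k < m -> P k t.
Proof.
move=> mono; elim: m => [|m IH] h; first by exists 0.
have [t ht] := IH (fun k km => h k (ltnW km)).
have [s hs] := h m (leqnn _).
exists (maxn s t) => k; rewrite ltnS leq_eqVlt => /predU1P[->|km].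
  by apply: mono hs; exact: leq_maxl.
by apply: mono (ht _ km); exact: leq_maxr.
Qed.

(** The finitely many triples on a discriminating path have a common bound on
    their orders, as the sets of triples of order at most [t] grow with [t]. *)
Lemma ordered_order_upto x y z : ordered x y z -> exists t, order_upto G t (triple_of G x y z).
Proof.
elim=> {x y z} [v m c dv _ IH|x y z _ [t h]]; last first.
  by exists t; rewrite -rev_triple_of; exact: order_upto_rev.
have tp : three_path G (triple_of G (v m) (v m.+1) c).
  apply/three_pathP; exists (v m), (v m.+1), c.
  by split=> //; [exact: disc_adj dv _ _ | exact: disc_last dv | exact: disc_end dv _ _].
case: m => [|m] in dv IH tp *.
  by exists 0; split=> //; exact: disc_nadj dv.
have [|t ht] := bounded_choice _ IH.
  by move=> k s t st; exact: order_upto_leq.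
exists t.+1; have [h|h] := pselect (order_upto G t (triple_of G (v m.+1) (v m.+2) c)).
  by left.
right; split=> //.
pose w k := if k <= m.+2 then v k else c.
have wE k : k <= m.+2 -> w k = v k by rewrite /w => ->.
have wc : w m.+3 = c by rewrite /w ltnn.
exists (v 0), (marked_walk G w 0 m.+3), [seq triple_of G (v k) (v k.+1) (v k.+2) | k <- iota 0 m.+1],
  (triple_of G (v m.+1) (v m.+2) c); split.
- rewrite /discriminating -(wE 0) // endpoint_marked_walk wc wE // (disc_nadj dv) -(wE 0) //.
  apply/and5P; split=> //.
  + apply: is_path_marked_walk => //.
      move=> k; rewrite ltnS leq_eqVlt => /predU1P[->|km].
        by rewrite wc wE //; exact: disc_last dv.
      by rewrite !wE //; [exact: disc_adj dv _ _| exact: ltnW].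
    move=> i j; rewrite leq_eqVlt => /predU1P[->|im]; rewrite leq_eqVlt => /predU1P[->|jm] //.
    * rewrite wc wE // => /esym/eqP; rewrite (negPf (disc_end dv _)) //.
    * rewrite wc wE // => /eqP; rewrite (negPf (disc_end dv _)) //.
    * by rewrite !wE //; exact: disc_inj dv _ _ _ _.
  + rewrite triples_marked_walk map_iota_rcons wc !wE //.
    rewrite eqseq_rcons eqxx andbT; apply/eqP.
    apply/eq_in_map => k; rewrite mem_iota => hk; rewrite !wE //; lia.
  + apply/allP => T /mapP[k]; rewrite mem_iota => hk ->.
    by apply/andP; split; [exact: disc_col dv _ _ | exact: disc_dir dv _ _].
- by left.
- by move=> T /mapP[k]; rewrite mem_iota => hk ->; exact: ht.
Qed.

Lemma collider_with_orderE x y z :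
  collider_with_order G x y z <-> collides G x y z /\ ordered x y z.
Proof.
split.
  case=> m [n [cl [t /has_order_upto/order_upto_ordered]]].
  case=> x' [y' [z' [[-> em -> en ->] h]]]; split=> //.
  by move: cl; rewrite /collider em en.
case=> cl /ordered_order_upto[t /order_upto_has[s h]].
exists (marks_of G x y), (marks_of G y z); split=> //.
by exists s.
Qed.

End Order.

(** * Separating nonadjacent nodes of a maximal graph *)

Section Maximal.
Variables (V : finType) (G : lmg V).
Hypothesis qaG : quasi_ancestral G.

Definition bid_in (S : {set V}) : rel V :=
  fun u w => [&& bid G u w, u \in S & w \in S].

(** Maximality in terms of inducing paths. Between nonadjacent nodes these
    consist of bidirected edges among ancestors of the two ends, see
    [inducing_bid]. *)
Definition maximal := forall x y, x != y -> ~~ adjacent G x y ->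
  ~~ connect (bid_in (an G [set x; y])) x y.

Lemma an_pairP z x y :
  reflect (ancestor G z x \/ ancestor G z y) (z \in an G [set x; y]).
Proof.
apply: (iffP (mem_an _ _ _)) => [[c]|[h|h]].
- by rewrite !inE => /orP[/eqP->|/eqP->]; [left|right].
- by exists x; rewrite // !inE eqxx.
- by exists y; rewrite // !inE eqxx orbT.
Qed.

Lemma arr_bid x y : arr G x y -> arr G y x -> bid G x y.
Proof. by rewrite {1}/arr => /orP[//|/(dir_tail qaG)->]. Qed.

(** If one end were an ancestor of the other, so would be the node next to the
    latter, against its arrowhead there. The remaining marks follow. *)
Lemma inducing_bid v n : 1 < n -> ~~ adjacent G (v 0) (v n) ->
  (forall k, k.+1 < n -> collides G (v k) (v k.+1) (v k.+2)) ->
  (forall k, 0 < k < n -> v k \in an G [set v 0; v n]) ->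
  connect (bid_in (an G [set v 0; v n])) (v 0) (v n).
Proof.
move=> n1 nadj hc ha.
have a1 : arr G (v 0) (v 1) by have /andP[] := hc 0 n1.
have an1 : arr G (v n) (v n.-1).
  by case: (n) n1 hc => [|[|m]] // _ hc'; have /andP[] := hc' m (leqnn _).
have n0 : ~~ ancestor G (v 0) (v n).
  apply/negP => h; have /ha/an_pairP[] : 0 < n.-1 < n by lia.
    by move/anc_trans/(_ h); rewrite (negPf (arr_anc qaG an1)).
  by rewrite (negPf (arr_anc qaG an1)).
have nn : ~~ ancestor G (v n) (v 0).
  apply/negP => h; have /an_pairP := ha 1 n1 => -[].
    by rewrite (negPf (arr_anc qaG a1)).
  by move/anc_trans/(_ h); rewrite (negPf (arr_anc qaG a1)).
have inS k : k <= n -> v k \in an G [set v 0; v n].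
  case: k => [|k] kn; first by apply/an_pairP; left; exact: anc_refl.
  by move: kn; rewrite leq_eqVlt => /predU1P[->|kn]; [apply/an_pairP; right; exact: anc_refl | exact: ha].
suff h k : k <= n -> connect (bid_in (an G [set v 0; v n])) (v 0) (v k) by exact: h.
elim: k => [|k IH] kn; first exact: connect0.
apply: (connect_trans (IH (ltnW kn))); apply: connect1.
rewrite /bid_in !inS ?andbT //; last exact: ltnW.
case: k kn {IH} => [|k] kn.
  have /andP[_ _] := hc 0 n1.
  move: (a1) => /orP[//|d].
  have /an_pairP := ha 1 n1 => -[h|/(anc_trans (dir_anc d)) h].
    by rewrite (negPf (qa_dir qaG d)) in h.
  by rewrite h in n0.
have /andP[h1 h2] := hc k kn.
have [e|kn'] := eqVneq k.+2 n; last first.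
  have kn2 : k.+2 < n by lia.
  by apply: arr_bid => //; have /andP[] := hc k.+1 kn2.
move: (h2); rewrite e bid_sym => /orP[//|d].
have /an_pairP := ha k.+1 kn => -[/(anc_trans (dir_anc d)) h|h].
  by rewrite h in nn.
by rewrite (negPf (qa_dir qaG d)) in h.
Qed.

Definition und_or_dir := [rel u w | und G u w || dir G u w].

Definition anterior x y := [set z | connect und_or_dir z x || connect und_or_dir z y].

(** Besides the anterior nodes, all sources are included, and so are the nodes
    with an undirected edge that one of the two ends points to: there an
    anterior walk can be stopped by an arrowhead. Neither addition opens a
    collider. *)
Definition sepset x y := [set z | [&& z != x, z != y &
  [|| z \in anterior x y, source G z
    | selection_adjacent G z && (arr G x z || arr G y z)]]].

Lemma sepset_sym x y : sepset x y = sepset y x.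
Proof.
apply/setP => z; rewrite !inE; set a := z != x; set b := z != y.
rewrite [X in _ = [&& _, _ & [|| X, _ | _]]]orbC [X in _ = [&& _, _ & [|| _, _ | _ && X]]]orbC.
by case: a; case: b.
Qed.

Lemma source_anc z u : source G z -> ancestor G u z -> u = z.
Proof.
move=> /forallP sz /connectP[p]; case/lastP: p => [_ ->//|p w].
rewrite rcons_path last_rcons => /andP[_ h] e; subst w.
by have := sz (last u p); rewrite (dir_arr h) andbF.
Qed.

(** Such a node has no undirected edge, and a node entered by a directed edge
    from a non-source has none either. *)
Lemma anterior_anc z a b x : arr G a z -> arr G b z -> a != b ->
  connect und_or_dir z x -> ancestor G z x.
Proof.
move=> az bz ab /connectP[p]; elim/last_ind: p x => [|p w IH] x.
  by move=> _ ->; exact: anc_refl.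
rewrite rcons_path last_rcons => /andP[hp h] ->.
have IH' := IH _ hp erefl.
apply: (anc_trans IH'); apply: dir_anc.
move: h => /= /orP[u|//].
case/connectP: IH' => q; case/lastP: q => [|q y] hq e.
  by rewrite e /= (col_no_und qaG (x := a) (z := b)) ?/collides ?az ?bz in u.
move: hq; rewrite rcons_path => /andP[hq d].
have hz : source G (last z q) -> last z q = z -> False.
  by move=> s e'; have := arr_source az; rewrite -e' s.
rewrite e last_rcons in u.
have s := qa_und qaG u (dir_arr d).
case: hz => //; apply/esym; apply: (source_anc s).
by apply/connectP; exists q.
Qed.

(** Following the tail, the walk stays anterior until it meets the end [y] or a
    collider; the blocking cases are excluded by the extra nodes of [sepset].
    The induction is on the distance to the end. *)
Lemma sep_right x y v n : min_walk G (sepset x y) v n -> v 0 = x -> v n = y ->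
  (forall k, k.+1 < n -> collides G (v k) (v k.+1) (v k.+2) -> v k.+1 \in anterior x y) ->
  forall d k, k + d.+1 = n -> ~~ arr G (v k.+1) (v k) -> v k \in anterior x y.
Proof.
move=> mv v0 vn hc; have [[av pv _ _] _] := mv.
have step k : k < n -> ~~ arr G (v k.+1) (v k) -> v k.+1 \in anterior x y ->
    v k \in anterior x y.
  move=> kn t; have h : und_or_dir (v k) (v k.+1) by exact: tail_und_or_dir (av _ kn) t.
  by rewrite !inE => /orP[h'|h']; rewrite (connect_trans (@connect1 _ und_or_dir _ _ h) h') ?orbT.
have int k : 0 < k < n -> v k != x /\ v k != y.
  move=> kn; rewrite -v0 -vn !(min_walk_inj_eq qaG mv); lia.
elim=> [|d IH] k kd t; apply: step => //; try lia.
  by rewrite (_ : k.+1 = n) ?vn; [rewrite inE connect0 orbT | lia].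
have kn : k.+1 < n by lia.
have := pv k kn; rewrite /pass; case: ifP => [c _|nc]; first exact: hc.
rewrite inE; have [-> -> /=] := int k.+1 kn.
rewrite negb_or => /andP[_]; rewrite negb_or => /andP[_] hU.
have [a2|/IH] := boolP (arr G (v k.+2) (v k.+1)); last by apply; lia.
rewrite a2 andbT in nc.
have u' : und G (v k.+1) (v k).
  have /orP[|/dir_arr e] := tail_und_or_dir (av k (ltnW kn)) t; first by rewrite und_sym.
  by rewrite e in nc.
have s2 := qa_und qaG u' a2.
have sel : selection_adjacent G (v k.+1) by apply/existsP; exists (v k).
have [e|kn2] := eqVneq k.+2 n.
  by rewrite sel -vn -e a2 orbT in hU.
have := pv k.+1; rewrite /pass => /(_ _); rewrite (_ : arr G (v k.+1) (v k.+2) = false) /=; last first.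
  by apply: contraTF s2; exact: arr_source.
rewrite inE; have [|-> -> /=] := int k.+2; first lia.
by rewrite s2 orbT /=; move=> /(_ ltac:(lia)).
Qed.

(** On a connecting path every node would be anterior to [x] or [y], so all
    inner nodes would be colliders and the path would be inducing. *)
Lemma separated x y : maximal -> x != y -> ~~ adjacent G x y ->
  ~ connecting G (sepset x y) x y.
Proof.
move=> max xy nadj /connecting_min_walk[v [n [v0 vn mv]]].
have [[av pv v0C vnC] _] := mv.
have int k : 0 < k < n -> v k != x /\ v k != y.
  by move=> kn; rewrite -v0 -vn !(min_walk_inj_eq qaG mv); lia.
have n1 : 1 < n.
  move: av; case: (n) vn => [|[|//]] vn av.
    by rewrite -v0 -vn eqxx in xy.
  by move: nadj; rewrite -v0 -vn av.
(* An ancestor of one of the extra nodes of the separating set is that node or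
   a source, so it is not a collider. *)
have hc k : k.+1 < n -> collides G (v k) (v k.+1) (v k.+2) -> v k.+1 \in anterior x y.
  move=> kn c; have := pv k kn; rewrite /pass [_ && _]c => /mem_an[w].
  have nsel : ~~ selection_adjacent G (v k.+1).
    apply/existsPn => u; rewrite (col_no_und qaG _ c) //.
    by rewrite (min_walk_inj_eq qaG mv); lia.
  have nsrc : ~~ source G (v k.+1) by have /andP[/arr_source] := c.
  rewrite inE => /and3P[wx wy /or3P[]].
  - rewrite !inE => h anc.
    have anc' : connect und_or_dir (v k.+1) w.
      apply: connect_sub anc => a b d; apply: connect1 => /=; apply/orP; right; exact: d.
    by case/orP: h => h; rewrite (connect_trans anc' h) ?orbT.
  - by move=> s /(source_anc s) e; rewrite e s in nsrc.
  - case/andP=> sw aw /connectP[p]; case/lastP: p => [|p u].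
      by move=> _ /= e; rewrite -e sw in nsel.
    rewrite rcons_path last_rcons => /andP[hp d] e; subst u.
    case/existsP: (sw) => u uw; case/existsP: sw => u' uw'.
    have sl := qa_und qaG uw (dir_arr d).
    have e : v k.+1 = last (v k.+1) p.
      by apply: (source_anc sl); apply/connectP; exists p.
    by rewrite -e (negPf nsrc) in sl.
have tailR k : k < n -> ~~ arr G (v k.+1) (v k) -> v k \in anterior x y.
  move=> kn; apply: (sep_right mv v0 vn hc (d := n - k.+1)); lia.
have tailL k : 0 < k -> k <= n -> ~~ arr G (v k.-1) (v k) -> v k \in anterior x y.
  move=> k0 kn t.
  have mv' := min_walk_rev mv; rewrite sepset_sym in mv'.
  have -> : anterior x y = anterior y x by apply/setP => z; rewrite !inE orbC.
  have := sep_right mv' _ _ _ (d := k.-1) (k := n - k).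
  rewrite subn0 subnn => /(_ vn v0) /=; rewrite subKn // (_ : n - (n - k).+1 = k.-1); last lia.
  apply=> //; last lia.
  move=> j jn; rewrite /collides andbC => c.
  have -> : anterior y x = anterior x y by apply/setP => z; rewrite !inE orbC.
  have := hc (n - j.+2); rewrite (_ : (n - j.+2).+1 = n - j.+1); last lia.
  rewrite (_ : (n - j.+1).+1 = n - j); last lia.
  by apply=> //; lia.
have cols k : k.+1 < n -> collides G (v k) (v k.+1) (v k.+2).
  move=> kn; apply/negPn/negP => nc.
  have : v k.+1 \in anterior x y.
    move: nc; rewrite /collides negb_and => /orP[|] t; last exact: tailR.
    by apply: tailL; rewrite // ltnW.
  have := pv k kn; rewrite /pass [_ && _](negPf nc) inE.
  by have [-> ->] := int k.+1 kn; rewrite /= => /norP[/negPf->].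
have := max x y xy nadj.
rewrite -v0 -vn inducing_bid // ?v0 ?vn //.
case=> // k kn; have := hc k kn (cols k kn).
have /andP[a1 a2] := cols k kn.
have ne : v k != v k.+2 by rewrite (min_walk_inj_eq qaG mv); lia.
rewrite inE => /orP[] h; apply/an_pairP; [left|right].
  exact: anterior_anc a1 a2 ne h.
exact: anterior_anc a1 a2 ne h.
Qed.

End Maximal.

(** * Markov equivalent graphs have the same colliders with order *)

Section Transfer.
Variables (V : finType) (G H : lmg V).
Hypotheses (qaG : quasi_ancestral G) (qaH : quasi_ancestral H).
Hypothesis eq_adj : forall x y, adjacent G x y = adjacent H x y.

(** What both directions of the criterion need: the same status for a triple
    that a common path discriminates in both graphs. *)
Definition agree := forall v m c, disc_path G v m c -> disc_path H v m c ->
  (forall k, k < m -> ordered G (v k) (v k.+1) (v k.+2)) ->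
  (forall k, k < m -> ordered H (v k) (v k.+1) (v k.+2)) ->
  collides G (v m) (v m.+1) c = collides H (v m) (v m.+1) c.

Lemma disc_prefix (K : lmg V) v m c k : disc_path K v m c -> k < m -> disc_path K v k c.
Proof.
case=> h1 h2 h3 h4 h5 h6 h7 km; split=> //.
- by move=> j jk; apply: h1; lia.
- exact: arr_adj (dir_arr (h7 _ km)).
- by move=> i j hi hj; apply: h3; lia.
- by move=> i hi; apply: h4; lia.
- by move=> j jk; apply: h6; lia.
- by move=> j jk; apply: h7; lia.
Qed.

(** The orientation [v k.+1 -> c] is transferred one node at a time: the initial
    part of the path discriminates [v k.+1] for [c], where it is not a
    collider, although it is one between its neighbours on the path. *)
Lemma ordered_transfer (ag : agree) x y z : ordered G x y z ->
  ordered H x y z /\ collides G x y z = collides H x y z.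
Proof.
elim=> {x y z} [v m c dG oG IH|x y z _ [h e]]; last first.
  by split; [exact: ordered_sym | rewrite /collides andbC [RHS]andbC; exact: e].
suff dH : disc_path H v m c.
  by split; [apply: ordered_disc dH _ | apply: ag] => // k /IH[].
suff dirH k : k < m -> dir H (v k.+1) c.
  case: dG => h1 h2 h3 h4 h5 h6 h7; split=> //; rewrite -?eq_adj //.
    by move=> k km; rewrite -eq_adj h1.
  by move=> k km; have [_ <-] := IH k km; exact: h6.
elim/ltn_ind: k => k IHk km.
have dGk := disc_prefix dG km.
have dHk : disc_path H v k c.
  case: dGk => h1 h2 h3 h4 h5 h6 h7; split=> //; rewrite -?eq_adj //.
  - by move=> j jk; rewrite -eq_adj h1.
  - by move=> j jk; have [|_ <-] := IH j; [lia | exact: h6].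
  - by move=> j jk; apply: IHk => //; lia.
have e : collides G (v k) (v k.+1) c = collides H (v k) (v k.+1) c.
  apply: ag => // j jk; first by apply: oG; lia.
  by have [] := IH j; [lia|].
have cH : collides H (v k) (v k.+1) (v k.+2).
  by have [_ <-] := IH k km; exact: disc_col dG _ km.
have ne : v k != v k.+2 by apply/eqP => /(disc_inj dG); lia.
have : ~~ arr H c (v k.+1).
  move: e; rewrite /collides (dir_tail qaG (disc_dir dG km)) andbF.
  by have /andP[-> _] /= := cH; move=> <-.
have : adjacent H (v k.+1) c by rewrite -eq_adj (disc_last dGk).
by move=> a t; have := tail_und_or_dir a t; rewrite (col_no_und qaH _ cH).
Qed.

End Transfer.

Lemma agree_sym (V : finType) (G H : lmg V) : agree G H -> agree H G.
Proof. by move=> ag v m c dH dG oH oG; rewrite ag. Qed.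

Section Separation.
Variables (V : finType) (K : lmg V) (C : {set V}).
Hypothesis qaK : quasi_ancestral K.

(** The nodes [v 1, ..., v m] are parents of [c] and can be reached once the
    earlier ones are in [C], so all of them have to be in [C]; then [v m.+1]
    is reached as well, and its membership has to block its status. *)
Lemma disc_sep v m c : disc_path K v m c -> ~ connecting K C (v 0) c ->
  v 0 \notin C -> c \notin C -> (v m.+1 \in C) = ~~ collides K (v m) (v m.+1) c.
Proof.
move=> dK nc v0C cC.
have hop k : k <= m -> (forall j, j < k -> v j.+1 \in C) -> forall t,
    pass K C (v k.+1) (arr K (v k) (v k.+1)) t -> reach K C (v 0) (v k.+1) t.
  elim: k => [|k IH] km hC t pt.
    by apply: reachS pt; [exact: reach0 | exact: disc_adj dK _ _].
  apply: reachS pt; last exact: disc_adj dK _ _.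
  apply: IH; [lia | by move=> j jk; apply: hC; lia | ].
  by rewrite /pass [_ && _](disc_col dK) // sub_an // hC.
have block k : k <= m -> adjacent K (v k.+1) c -> (forall j, j < k -> v j.+1 \in C) ->
    ~~ pass K C (v k.+1) (arr K (v k) (v k.+1)) (arr K c (v k.+1)).
  move=> km ac hC; apply/negP => pt; apply: nc.
  apply: (reachS (hop k km hC _ pt) ac).
  by rewrite /pass andbF.
have inC k : k < m -> v k.+1 \in C.
  elim/ltn_ind: k => k IH km.
  have d := disc_dir dK km.
  have := block k (ltnW km) (arr_adj (dir_arr d)) => /(_ _).
  rewrite /pass (dir_tail qaK d) andbF negbK; apply=> j jk; apply: IH => //; lia.
have := block m (leqnn m) (disc_last dK) inC; rewrite /pass -/(collides K _ _ _).
case: ifP => _ /=; last by rewrite negbK.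
by move=> h; apply: contraNF h; exact: sub_an.
Qed.

End Separation.

Section FromMarkov.
Variables (V : finType) (G H : lmg V).
Hypotheses (qaG : quasi_ancestral G) (qaH : quasi_ancestral H).
Hypothesis maxG : maximal G.
Hypothesis me : markov_equiv G H.

Lemma markov_conn (C : {set V}) x y : x != y -> x \notin C -> y \notin C ->
  ~ connecting G C x y -> ~ connecting H C x y.
Proof.
move=> xy xC yC nc.
have : indep_model G [set x] [set y] C.
  apply/(indep_conn qaG); rewrite !disjoints1 !inE; split=> //.
  by move=> u w /set1P-> /set1P->.
by move/me/(indep_conn qaH)=> [_ _ _]; apply; exact: set11.
Qed.

Lemma sepset_ends x y : (x \notin sepset G x y) /\ (y \notin sepset G x y).
Proof. by rewrite !inE !eqxx /= andbF. Qed.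

Lemma adj_conn (K : lmg V) (C : {set V}) x y : adjacent K x y -> x \notin C -> y \notin C ->
  connecting K C x y.
Proof.
by move=> xy xC yC; apply: (reachS (reach0 _ _ xC) xy); rewrite /pass andbF.
Qed.

Lemma markov_adj x y : adjacent H x y -> adjacent G x y.
Proof.
move=> hxy; apply/contraT => nxy.
have xy : x != y by apply: contraTneq hxy => ->; rewrite adj_irr.
have [xC yC] := sepset_ends x y.
by case: (markov_conn xy xC yC (separated qaG maxG xy nxy)); exact: adj_conn.
Qed.

Lemma markov_agree : agree G H.
Proof.
move=> v m c dG dH _ _.
have ne := disc_end dG (leq0n _); have nadj := disc_nadj dG.
have [xC yC] := sepset_ends (v 0) c.
have sG := separated qaG maxG ne nadj.
have sH := markov_conn ne xC yC sG.
by apply: negb_inj; rewrite -(disc_sep qaG dG sG) // (disc_sep qaH dH sH).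
Qed.

End FromMarkov.

(** * Triples of a minimal walk have an order *)

Section Run.
Variables (V : finType) (G : lmg V) (C : {set V}).
Hypothesis qaG : quasi_ancestral G.

(** From a collider [v i.+1 -> t] in [an C], either the walk can
    step into [t] from an earlier node, or the nodes before it are colliders and
    parents of [t] back to a node not adjacent to [t]. Indeed an arrowhead at
    [t] is inherited by each adjacent predecessor ([triangle]), and stepping
    from such a predecessor fails only if it is a collider with a tail
    towards [t]. *)
Lemma discriminate_or_bypass v n t i : open_walk G C v n -> i < n ->
  arr G (v i) (v i.+1) -> dir G (v i.+1) t -> v i.+1 \in an G C ->
  exists j, [/\ j <= i,
    forall k, j < k <= i -> collides G (v k.-1) (v k) (v k.+1) && dir G (v k) t,
    arr G (v j) (v j.+1) & ~~ adjacent G (v j) t \/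
      [/\ adjacent G (v j) t, arr G (v j) t & ok_from_left G C v j (arr G t (v j))]].
Proof.
move=> [av pv _ _]; elim: i => [|i IH] lt a1 d1 anc1.
  exists 0; split=> //; first by case.
  have [adj|] := boolP (adjacent G (v 0) t); last by left.
  by right; split=> //; exact: triangle d1 adj.
have [adj|nadj] := boolP (adjacent G (v i.+1) t); last first.
  by exists i.+1; split=> //; [lia | left].
have at_ := triangle qaG a1 d1 adj.
have [ok|nok] := boolP (ok_from_left G C v i.+1 (arr G t (v i.+1))).
  by exists i.+1; split=> //; [lia | right].
move: nok; rewrite {1}/ok_from_left /= {1}/pass; have := pv i lt; rewrite {1}/pass.
set u := v i.+1 in a1 d1 adj at_ *; set w := v i; set b := v i.+2 in a1 d1 anc1 *.
have [/andP[wu bu] anu|nc _] := boolP (arr G w u && arr G b u).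
  rewrite wu /=; have [tu /negP//|tu _] := boolP (arr G t u).
  have dut : dir G u t by exact: tail_dir.
  have [j [ji cj aj sj]] := IH (ltnW lt) wu dut anu.
  exists j; split=> //; first exact: leqW.
  move=> k /andP[jk]; rewrite leq_eqVlt => /predU1P[->|ki].
    by rewrite /= /collides wu bu.
  by apply: cj; rewrite jk -ltnS.
have [/andP[wu tu] /negP nan|_] := boolP (arr G w u && arr G t u).
  case: nan; apply: anc_an anc1; apply: dir_anc; apply: tail_dir => //.
  by rewrite wu in nc.
by rewrite negbK => uC; case/negP: nc; move: (pv i lt); rewrite /pass -/u uC; case: ifP.
Qed.

End Run.

Section Types.
Variables (V : finType) (G : lmg V).
Hypothesis qaG : quasi_ancestral G.

Definition left_disc (v : nat -> V) i j :=
  [/\ j < i, ~~ adjacent G (v j) (v i.+1) &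
    forall k, j < k < i -> collides G (v k.-1) (v k) (v k.+1) && dir G (v k) (v i.+1)].

Definition right_disc (v : nat -> V) i j :=
  [/\ i < j, ~~ adjacent G (v j) (v i.-1) &
    forall k, i < k < j -> collides G (v k.-1) (v k) (v k.+1) && dir G (v k) (v i.-1)].

Definition npath (v : nat -> V) n :=
  (forall k, k < n -> adjacent G (v k) (v k.+1)) /\
  (forall i j, i <= n -> j <= n -> v i = v j -> i = j).

Definition rev_walk (v : nat -> V) n := fun k => v (n - k).

Lemma npath_rev v n : npath v n -> npath (rev_walk v n) n.
Proof.
move=> [av iv]; split; rewrite /rev_walk.
  move=> k kn; rewrite adj_sym (_ : n - k = (n - k.+1).+1); last lia.
  by apply: av; lia.
by move=> i j hi hj /iv; lia.
Qed.

Lemma left_right v n i j : 0 < i -> i < n ->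
  left_disc v i j -> right_disc (rev_walk v n) (n - i) (n - j).
Proof.
move=> i0 in_ [ji nadj hk]; split; first lia.
  have e1 : n - (n - j) = j by lia.
  have e2 : n - (n - i).-1 = i.+1 by lia.
  by rewrite /rev_walk e1 e2.
move=> k kn; have := hk (n - k) ltac:(lia); rewrite /rev_walk.
rewrite (_ : n - k.-1 = (n - k).+1); last lia.
rewrite (_ : n - k.+1 = (n - k).-1); last lia.
rewrite (_ : n - (n - i).-1 = i.+1); last lia.
by case/andP=> /andP[c1 c2] d; rewrite /collides c1 c2.
Qed.

Lemma left_right_rev v n i j : 0 < i -> i < n ->
  left_disc (rev_walk v n) i j -> right_disc v (n - i) (n - j).
Proof.
move=> i0 in_ [ji nadj hk]; split; first lia.
  by move: nadj; rewrite /rev_walk (_ : (n - i).-1 = n - i.+1); [|lia].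
move=> k kn; have := hk (n - k) ltac:(lia); rewrite /rev_walk.
rewrite (_ : n - (n - k).-1 = k.+1); last lia.
rewrite (_ : n - (n - k) = k); last lia.
rewrite (_ : n - (n - k).+1 = k.-1); last lia.
rewrite (_ : n - i.+1 = (n - i).-1); last lia.
by case/andP=> /andP[c1 c2] d; rewrite /collides c1 c2.
Qed.

Lemma right_left v n i j : 0 < i -> i < n -> j <= n ->
  right_disc v i j -> left_disc (rev_walk v n) (n - i) (n - j).
Proof.
move=> i0 in_ jn [ij nadj hk]; split; first lia.
  by move: nadj; rewrite /rev_walk subKn // (_ : n - (n - i).+1 = i.-1); [|lia].
move=> k kn; have := hk (n - k) ltac:(lia); rewrite /rev_walk.
rewrite (_ : n - k.-1 = (n - k).+1); last lia.
rewrite (_ : n - k.+1 = (n - k).-1); last lia.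
rewrite (_ : n - (n - i).+1 = i.-1); last lia.
by case/andP=> /andP[c1 c2] d; rewrite /collides c1 c2.
Qed.

Lemma left_ordered v n i j : npath v n -> 0 < i -> i < n -> left_disc v i j ->
  (forall k, j < k < i -> ordered G (v k.-1) (v k) (v k.+1)) ->
  ordered G (v i.-1) (v i) (v i.+1).
Proof.
move=> [av iv] i0 in_ [ji nadj hk] ho.
have h : disc_path G (fun k => v (j + k)) (i.-1 - j) (v i.+1).
  split.
  - by move=> k ki; rewrite addnS; apply: av; lia.
  - by rewrite (_ : j + _ = i); [apply: av | lia].
  - by move=> a b ha hb /iv; lia.
  - by move=> a ha; apply/eqP => /iv; lia.
  - by rewrite addn0.
  - move=> k hk'; have /andP[+ _] := hk (j + k.+1) ltac:(lia).
    by rewrite !addnS.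
  - by move=> k hk'; have /andP[] := hk (j + k.+1) ltac:(lia).
have := ordered_disc h.
rewrite (_ : j + (i.-1 - j) = i.-1); last lia.
rewrite (_ : j + (i.-1 - j).+1 = i); last lia.
by apply=> k hk'; have := ho (j + k.+1); rewrite !addnS /=; apply; lia.
Qed.

Lemma right_ordered v n i j : npath v n -> 0 < i -> i < n -> j <= n -> right_disc v i j ->
  (forall k, i < k < j -> ordered G (v k.-1) (v k) (v k.+1)) ->
  ordered G (v i.-1) (v i) (v i.+1).
Proof.
move=> pv i0 in_ jn rv ho; apply: ordered_sym.
have := left_ordered (npath_rev pv) _ _ (right_left i0 in_ jn rv).
rewrite /rev_walk subKn; last exact: ltnW.
rewrite (_ : n - (n - i).-1 = i.+1); last lia.
rewrite (_ : n - (n - i).+1 = i.-1); last lia.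
apply; [lia | lia | move=> k kn].
rewrite (_ : n - k.-1 = (n - k).+1); last lia.
rewrite (_ : n - k.+1 = (n - k).-1); last lia.
by apply: ordered_sym; apply: ho; lia.
Qed.

Hypothesis maxG : maximal G.

(** If the discriminating path for [k] reached beyond [i], the two paths would
    overlap so that all nodes between [v j] and [v i.+1] are colliders and
    ancestors of one of these two nonadjacent nodes. *)
Lemma right_within_left v n i j k j' : npath v n -> i < n ->
  left_disc v i j -> j < k < i -> right_disc v k j' -> j' <= n -> j' <= i.
Proof.
move=> [av iv] in_ [ji nadj hi] /andP[jk ki] [kj' nadj' hk] j'n.
rewrite leqNgt; apply/negP => lt.
have /andP[ci dik] := hk i ltac:(lia).
have aii : arr G (v i.+1) (v i) by case/andP: ci.
have [jk'|] := ltnP j k.-1.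
  have /andP[_ dki] := hi k.-1 ltac:(lia).
  have := anc_trans (dir_anc dik) (dir_anc dki).
  by rewrite (negPf (arr_anc qaG aii)).
(* The overlap starts right after v j and will have to end right before v i.+1. *)
move=> k1; have ej : k.-1 = j by lia.
rewrite ej in hk nadj' dik.
have [lt'|] := ltnP i.+1 j'.
  have /andP[_ d] := hk i.+1 ltac:(lia).
  by move: nadj; rewrite adj_sym (arr_adj (dir_arr d)).
move=> le; have := maxG (x := v j) (y := v i.+1).
have ne : v j != v i.+1 by apply/eqP => /iv; lia.
move=> /(_ ne nadj); apply/negP/negPn.
have := inducing_bid qaG (v := fun l => v (j + l)) (n := i.+1 - j).
rewrite addn0 subnKC; last lia.
apply=> //; first lia.
  move=> l hl; rewrite !addnS.
  have [e|lt2] := eqVneq (j + l).+1 i; first by rewrite e; rewrite -e /= in ci *.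
  by have /andP[] := hi (j + l).+1 ltac:(lia).
move=> l hl; apply/an_pairP.
have [e|lt2] := eqVneq (j + l) i; first by rewrite e; left; exact: dir_anc.
by right; have /andP[_ /dir_anc] := hi (j + l) ltac:(lia).
Qed.

(** A left triple depends on triples before it. Those that are right triples
    depend only on later ones, but still before the left triple they serve
    ([right_within_left]). So the outer induction goes up and the inner one
    down. *)
Lemma all_left_ordered v n : npath v n ->
  (forall i, 0 < i < n -> (exists j, left_disc v i j) \/
      exists2 j, j <= n & right_disc v i j) ->
  forall i j, 0 < i < n -> left_disc v i j -> ordered G (v i.-1) (v i) (v i.+1).
Proof.
move=> pv types; elim/ltn_ind => i IH j /andP[i0 in_] li.
apply: (left_ordered pv i0 in_ li) => k.
move Ed: (i - k) => d; elim/ltn_ind: d k Ed => d IHd k Ed hk.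
have [|[j1 lk]|[j1 j1n rk]] := types k; first by lia.
  by apply: (IH k) lk; lia.
have j1i : j1 <= i by apply: (right_within_left pv in_ li hk rk).
apply: (right_ordered pv _ _ j1n rk); try lia.
by move=> l hl; apply: (IHd (i - l)) => //; lia.
Qed.

Lemma all_ordered v n : npath v n ->
  (forall i, 0 < i < n -> (exists j, left_disc v i j) \/
      exists2 j, j <= n & right_disc v i j) ->
  forall i, 0 < i < n -> ordered G (v i.-1) (v i) (v i.+1).
Proof.
move=> pv types i hi; have [i0 in_] := andP hi.
case: (types i hi) => [[j li]|[j jn ri]].
  exact: all_left_ordered pv types _ _ hi li.
have := right_left i0 in_ jn ri => li.
apply: ordered_sym.
have := all_left_ordered (npath_rev pv) _ _ li.
rewrite /rev_walk subKn; last exact: ltnW.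
rewrite (_ : n - (n - i).-1 = i.+1); last lia.
rewrite (_ : n - (n - i).+1 = i.-1); last lia.
apply; last lia.
move=> l hl; case: (types (n - l)); first lia.
  move=> [j1 l1]; right; exists (n - j1); first lia.
  by have := left_right (n := n) _ _ l1; rewrite subKn; [apply; lia | lia].
move=> [j1 j1n r1]; left; exists (n - j1).
by have := right_left _ _ j1n r1; rewrite subKn; [apply; lia | lia].
Qed.

End Types.

Section MinimalOrdered.
Variables (V : finType) (G : lmg V) (C : {set V}).
Hypothesis qaG : quasi_ancestral G.

(** Replacing [v i, v i.+1, v i.+2] by the chord can only fail at [v i] if this is
    a collider with a tail towards [v i.+2]: a newly created collider would
    be an ancestor of the collider [v i.+1]. *)
Lemma left_trouble v n i : min_walk G C v n -> i.+2 <= n ->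
  adjacent G (v i) (v i.+2) -> ~~ ok_from_left G C v i (arr G (v i.+2) (v i)) ->
  exists j, left_disc G v i.+1 j.
Proof.
move=> mv lt adj; have [ov _] := mv; have [av pv _ _] := ov.
case: i lt adj => [//|i] lt adj; rewrite {1}/ok_from_left /= {1}/pass.
have ab := av i.+1 (ltnW lt).
have ne k l : k < l -> l <= n -> v k != v l := @min_walk_inj _ _ _ qaG v n mv k l.
have := pv i (ltnW lt); rewrite {1}/pass.
(* Let u, a, b, c be v i, ..., v i.+3. Here a is a collider on the walk. *)
have [/andP[ua ba] ana|nc naC] := boolP (arr G (v i) (v i.+1) && arr G (v i.+2) (v i.+1)).
  rewrite ua /=; have [ca /negP//|ca _] := boolP (arr G (v i.+3) (v i.+1)).
  have ac : dir G (v i.+1) (v i.+3).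
    have := tail_und_or_dir adj ca.
    by rewrite (col_no_und qaG (x := v i) (z := v i.+2)) ?/collides ?ua ?ba // ne // ltnW.
  have bc := triangle qaG ba ac (av _ lt).
  have i1 : i < n := ltnW (ltnW lt).
  have [j [ji cj aj sj]] := discriminate_or_bypass qaG ov i1 ua ac ana.
  case: sj => [nadj|[adj' ar ok]].
    exists j; split=> //; first by rewrite !ltnS leqW.
    move=> k /andP[jk]; rewrite ltnS leq_eqVlt => /predU1P[->|ki].
      by rewrite /= /collides ua ba.
    by apply: cj; rewrite jk -ltnS.
  case: (min_chord (l := j) (r := i.+3) mv) => //; first by rewrite ltnS; apply: leq_trans ji _; exact: leqW.
  rewrite /ok_from_right ar; case: eqP => //= ne3.
  have := pv i.+2; rewrite bc; apply; rewrite ltn_neqAle lt andbT; exact/eqP.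
(* A node a outside C is only blocked as a new collider outside an C. *)
have [/andP[ua ca] naan|_ ] := boolP (arr G (v i) (v i.+1) && arr G (v i.+3) (v i.+1)); last first.
  by rewrite naC.
rewrite ua /= in nc.
have ab' : dir G (v i.+1) (v i.+2).
  have := tail_und_or_dir ab nc; case u: (und G _ _) => //= _.
  by have := qa_uniq qaG u ua ca => /eqP; rewrite (negPf (ne _ _ _ _)) //; apply: leqW.
case/negP: naan.
have cb : arr G (v i.+3) (v i.+2).
  apply/contraT => nt; have := tail_und_or_dir (av _ lt) nt.
  rewrite (no_und qaG _ (dir_arr ab') (arr_source ua)) /= => bc.
  have := anc_trans (dir_anc ab') (dir_anc bc).
  by rewrite (negPf (arr_anc qaG ca)).
apply: anc_an (dir_anc ab') _.
by have := pv i.+1 lt; rewrite /pass (dir_arr ab') cb.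
Qed.

(** The chord of a shielded triple must be blocked at one of its ends, and
    each blocked end yields a discriminating path on its side. *)
Lemma min_walk_ordered v n : maximal G -> min_walk G C v n ->
  forall i, i.+1 < n -> ordered G (v i) (v i.+1) (v i.+2).
Proof.
move=> maxG mv; have [ov _] := mv; have [av pv _ _] := ov.
have np : npath G v n.
  split=> // i j hi hj /eqP; rewrite (min_walk_inj_eq qaG mv) //; exact: eqP.
move=> i hi; apply: (all_ordered qaG maxG np _ (i := i.+1)) => // {hi}.
case=> // {}i hi.
have [adj|nadj] := boolP (adjacent G (v i) (v i.+2)); last first.
  by left; exists i; split=> // k /andP[h1]; rewrite ltnS leqNgt h1.
have [okl|nok] := boolP (ok_from_left G C v i (arr G (v i.+2) (v i))); last first.
  by left; exact: left_trouble mv hi adj nok.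
have [okr|nok] := boolP (ok_from_right G C v n i.+2 (arr G (v i) (v i.+2))).
  by case: (min_chord mv (l := i) (r := i.+2)).
(* The other end of the chord is treated on the reversed walk. *)
right; have := left_trouble (min_walk_rev mv) (i := n - i.+2).
have e1 : n - (n - i.+2).+2 = i by lia.
have e2 : n - (n - i.+2) = i.+2 by lia.
have e3 : (n - i.+2).+1 = n - i.+1 by lia.
have e4 : (n - i.+2 == 0) = (i.+2 == n) by lia.
have l1 : (n - i.+2).+2 <= n by lia.
rewrite l1 e1 e2 adj_sym => /(_ isT adj).
rewrite {1}/ok_from_left e4 pass_sym; move: nok; rewrite /ok_from_right.
have [|ne] := boolP (i.+2 == n) => //=.
have e5 : n - (n - i.+2).-1 = i.+3 by lia.
rewrite e2 e5 => nok /(_ nok)[j lj].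
have i0 : 0 < (n - i.+2).+1 by [].
have in_ : (n - i.+2).+1 < n by lia.
exists (n - j); first exact: leq_subr.
have := left_right_rev i0 in_ lj; by rewrite e3 subKn // ltnW.
Qed.

End MinimalOrdered.

(** * Graphs with the same colliders with order are Markov equivalent *)

Section MarkovFromAgree.
Variables (V : finType) (G H : lmg V) (C : {set V}).
Hypotheses (qaG : quasi_ancestral G) (qaH : quasi_ancestral H).
Hypothesis eq_adj : forall x y, adjacent G x y = adjacent H x y.
Hypothesis ag : agree G H.
Hypothesis maxG : maximal G.

(** Distance at most [k] to [C] along directed edges. *)
Fixpoint directed_within k u := (u \in C) ||
  (if k is k'.+1 then [exists w, dir G u w && directed_within k' w] else false).

Lemma directed_within_an k u : directed_within k u -> u \in an G C.
Proof.
elim: k u => [|k IH] u /=; first by rewrite orbF => /sub_an; apply.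
case/orP=> [/sub_an|/existsP[w /andP[d /IH]]]; first exact.
exact: anc_an (dir_anc d).
Qed.

Lemma an_directed_within u : u \in an G C -> exists k, directed_within k u.
Proof.
case/mem_an=> c cC /connectP[p]; elim: p u => [|w p IH] u /=.
  by move=> _ e; exists 0; rewrite /= -e cC.
case/andP=> d hp e; have [k hk] := IH w hp e.
by exists k.+1; apply/orP; right; apply/existsP; exists w; rewrite d.
Qed.

Lemma directed_withinS k u : directed_within k u -> directed_within k.+1 u.
Proof.
elim: k u => [|k IH] u; first by rewrite /= orbF => ->.
case/orP=> [uC|/existsP[w /andP[d hw]]]; apply/orP; [by left | right].
by apply/existsP; exists w; apply/andP; split=> //; exact: IH.
Qed.

Lemma agree_unshielded x y z : adjacent G x y -> adjacent G y z -> x != z ->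
  ~~ adjacent G x z -> collides G x y z = collides H x y z.
Proof.
move=> xy yz xz nxz.
have h (K : lmg V) : adjacent K x y -> adjacent K y z -> ~~ adjacent K x z ->
    disc_path K (fun k => if k is 0 then x else y) 0 z.
  move=> hxy hyz hxz; split=> //=.
  - by case.
  - have nx : x != y by apply: contraTneq hxy => ->; rewrite adj_irr.
    by move=> [|[|?]] [|[|?]] //= _ _ e; rewrite e eqxx in nx.
  - have nz : y != z by apply: contraTneq hyz => ->; rewrite adj_irr.
    by case.
by apply: (ag (h G _ _ _) (h H _ _ _)); rewrite -?eq_adj.
Qed.

(** A shortest directed path has no chords, so beyond its first edge its
    orientation is forced by unshielded noncolliders. *)
Lemma directed_within_transfer k e f : dir G e f -> arr H e f -> ~~ source H e ->
  directed_within k f -> ~~ directed_within k e -> f \in an H C.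
Proof.
elim: k e f => [|k IH] e f df af se.
  by rewrite /= orbF => /sub_an.
move=> hf he.
have [hf'|hf'] := boolP (directed_within k f).
  by apply: IH df af se hf' _; apply: contra he; exact: directed_withinS.
move: hf => /= /orP[/sub_an//|/existsP[g /andP[dg hg]]].
have [fC|nfC] := boolP (f \in C); first exact: sub_an.
have neg : e != g.
  by apply: (arr_dir_neq qaG) (dir_arr df) dg.
have nadj : ~~ adjacent G e g.
  apply: contra he => adj.
  have ag' := triangle qaG (dir_arr df) dg adj.
  have deg : dir G e g.
    apply: tail_dir => //; apply/negP => ge.
    by have := anc_trans (dir_anc df) (dir_anc dg); rewrite (negPf (arr_anc qaG ge)).
  by apply/orP; right; apply/existsP; exists g; rewrite deg.
have adjfg := arr_adj (dir_arr dg).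
have := agree_unshielded (arr_adj (dir_arr df)) adjfg neg nadj.
rewrite /collides (dir_tail qaG dg) andbF af /= => /esym/negbT nt.
have dgH : dir H f g.
  by apply: (tail_dir2 qaH af se) => //; rewrite -eq_adj.
apply: anc_an (dir_anc dgH) _.
exact: IH dg (dir_arr dgH) (arr_source af) hg hf'.
Qed.

(** A path discriminating the collider [v i.+1] for its child [d] transfers to
    [H] and fixes the edge to [d] there, since [v i.+1] remains a collider. *)
Lemma left_detour v n i d : min_walk G C v n -> i.+1 < n ->
  collides G (v i) (v i.+1) (v i.+2) -> dir G (v i.+1) d ->
  dir H (v i.+1) d \/
  exists j, [/\ j <= i, adjacent G (v j) d, arr G (v j) d & ok_from_left G C v j (arr G d (v j))].
Proof.
move=> mv lt cb dd; have [ov _] := mv; have [av pv _ _] := ov.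
have ord := min_walk_ordered qaG maxG mv.
have anb : v i.+1 \in an G C by have := pv _ lt; rewrite /pass [_ && _]cb.
have ab : arr G (v i) (v i.+1) by case/andP: cb.
have [j [ji cj aj [nadj|[adj ar ok]]]] := discriminate_or_bypass qaG ov (ltnW lt) ab dd anb; last first.
  by right; exists j.
left.
have dirj k : j < k <= i.+1 -> dir G (v k) d.
  case/andP=> jk; rewrite leq_eqVlt => /predU1P[->//|ki].
  by have /andP[] : collides G (v k.-1) (v k) (v k.+1) && dir G (v k) d by apply: cj; rewrite jk -ltnS.
have hD : disc_path G (fun k => v (j + k)) (i - j) d.
  split.
  - by move=> k ki; rewrite addnS; apply: av; lia.
  - by rewrite (_ : j + (i - j).+1 = i.+1) ?(arr_adj (dir_arr dd)) //; lia.
  - move=> a b ha hb /eqP; rewrite (min_walk_inj_eq qaG mv); lia.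
  - case=> [|a] ha; first by rewrite addn0; apply: (arr_dir_neq qaG aj); apply: dirj; lia.
    by rewrite addnS; apply: dir_neq; apply: dirj; lia.
  - by rewrite addn0.
  - move=> k hk.
    have /andP[+ _] : collides G (v (j + k.+1).-1) (v (j + k.+1)) (v (j + k.+1).+1)
        && dir G (v (j + k.+1)) d.
      by apply: cj; lia.
    by rewrite !addnS.
  - by move=> k hk; apply: dirj; lia.
have oD : ordered G (v i) (v i.+1) d.
  have := ordered_disc hD.
  rewrite (_ : j + (i - j) = i); last lia.
  rewrite (_ : j + (i - j).+1 = i.+1); last lia.
  by apply=> k hk; rewrite !addnS; apply: ord; lia.
have [_ e] := ordered_transfer qaG qaH eq_adj ag oD.
have [_ e'] := ordered_transfer qaG qaH eq_adj ag (ord i lt).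
rewrite cb in e'; have cH := esym e'.
move: e; rewrite {1}/collides (dir_tail qaG dd) andbF /collides.
have /andP[-> _] := cH; move=> /esym/negbT /= nt.
have ne : v i != v i.+2 := min_walk_inj qaG mv (leqW (ltnSn i)) lt.
have adjd : adjacent H (v i.+1) d by rewrite -eq_adj; exact: arr_adj (dir_arr dd).
by have := tail_und_or_dir adjd nt; rewrite (col_no_und qaH _ cH ne).
Qed.

(** With bypasses to [d] on both sides the walk could be rerouted through
    [d], which weighs less. *)
Lemma collider_transfer v n i : min_walk G C v n -> i.+1 < n ->
  collides G (v i) (v i.+1) (v i.+2) -> v i.+1 \in an H C.
Proof.
move=> mv lt cb; have [ov _] := mv; have [av pv _ _] := ov.
have anb : v i.+1 \in an G C by have := pv _ lt; rewrite /pass [_ && _]cb.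
have [_ e'] := ordered_transfer qaG qaH eq_adj ag (min_walk_ordered qaG maxG mv lt).
rewrite cb in e'; have /andP[abH _] := esym e'.
have [k0 hk0] := an_directed_within anb.
case: (ex_minnP (ex_intro (fun k => directed_within k (v i.+1)) k0 hk0)) => k hk mink.
case: k hk mink => [|k] /= hk mink; first by apply: sub_an; rewrite orbF in hk.
case/orP: hk => [/sub_an//|/existsP[d /andP[dd hd]]].
have done_ : dir H (v i.+1) d -> v i.+1 \in an H C.
  move=> dH; apply: (anc_an (dir_anc dH)).
  apply: directed_within_transfer dd (dir_arr dH) (arr_source abH) hd _.
  by apply/negP => /mink; rewrite ltnn.
have [//|[l [li adl al okl]]] := left_detour mv lt cb dd.
have i1 : i < n by clear -lt; lia.
have i2 : (n - i.+2).+1 < n by clear -lt; lia.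
have e1 : n - (n - i.+2) = i.+2 by clear -lt; lia.
have e2 : n - (n - i.+2).+1 = i.+1 by clear -lt; lia.
have e3 : n - (n - i.+2).+2 = i by clear -lt; lia.
have := left_detour (min_walk_rev mv) i2 (d := d); rewrite e1 e2 e3.
rewrite {1}/collides andbC => /(_ cb dd) [//|[r [ri adr ar okr]]].
have anc_d : d \in an G C := directed_within_an hd.
exfalso; apply: (min_detour mv (l := l) (i := i.+1) (r := n - r) (d := d)).
- by clear -li ri lt; lia.
- exact: leq_subr.
- exact: weight_dir.
- exact: adl.
- by rewrite adj_sym.
- exact: okl.
- by rewrite /pass al ar.
- move: okr; rewrite /ok_from_left /ok_from_right pass_sym.
  case: r ri {adr ar} => [|r] ri; first by rewrite subn0 (eqxx n).
  have e4 : n - r = (n - r.+1).+1 by clear -ri lt; lia.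
  by rewrite /= e4 => ->; rewrite orbT.
Qed.

Theorem connecting_transfer x y : connecting G C x y -> connecting H C x y.
Proof.
case/connecting_min_walk=> v [n [<- <- mv]]; have [[av pv v0 vn] _] := mv.
apply: open_walk_connecting; split=> // k kn; first by rewrite -eq_adj av.
have [_] := ordered_transfer qaG qaH eq_adj ag (min_walk_ordered qaG maxG mv kn).
rewrite /pass -/(collides H (v k) (v k.+1) (v k.+2)) => <-.
case: ifP => c; first exact: collider_transfer mv kn c.
by have := pv k kn; rewrite /pass [_ && _]c.
Qed.

End MarkovFromAgree.

Section MainCriterion.
Variables (V : finType) (G H : lmg V).
Hypotheses (qaG : quasi_ancestral G) (qaH : quasi_ancestral H).
Hypotheses (maxG : maximal G) (maxH : maximal H).

Lemma markov_equiv_sym (G' H' : lmg V) : markov_equiv G' H' -> markov_equiv H' G'.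
Proof. by move=> h A B C; split=> /h. Qed.

Lemma markov_eq_adj : markov_equiv G H -> forall x y, adjacent G x y = adjacent H x y.
Proof.
move=> me x y; apply/idP/idP; last exact: markov_adj me x y.
exact: markov_adj (markov_equiv_sym me) x y.
Qed.

Lemma markov_colliders : markov_equiv G H -> forall x y z,
  collider_with_order G x y z <-> collider_with_order H x y z.
Proof.
move=> me; have ea := markov_eq_adj me.
have ag := markov_agree qaG qaH maxG me.
move=> x y z; rewrite !collider_with_orderE //; split=> -[c o].
  by have [o' e] := ordered_transfer qaG qaH ea ag o; rewrite -e.
have [o' e] := ordered_transfer qaH qaG (fun x y => esym (ea x y)) (agree_sym ag) o.
by rewrite -e.
Qed.

Lemma colliders_agree : (forall x y z,
  collider_with_order G x y z <-> collider_with_order H x y z) -> agree G H.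
Proof.
move=> hc v m c dG dH oG oH; apply/idP/idP => h.
  have /hc/(collider_with_orderE qaH)[] // : collider_with_order G (v m) (v m.+1) c.
  by apply/collider_with_orderE => //; split=> //; exact: ordered_disc.
have /hc/(collider_with_orderE qaG)[] // : collider_with_order H (v m) (v m.+1) c.
by apply/collider_with_orderE => //; split=> //; exact: ordered_disc.
Qed.

Lemma colliders_markov : (forall x y, adjacent G x y = adjacent H x y) ->
  (forall x y z, collider_with_order G x y z <-> collider_with_order H x y z) ->
  markov_equiv G H.
Proof.
move=> ea /colliders_agree ag A B C; rewrite !indep_conn //.
split=> -[h1 h2 h3 h4]; split=> // x y xA yB h; apply: (h4 x y xA yB).
  exact: connecting_transfer (agree_sym ag) maxH _ _ h.
exact: connecting_transfer ag maxG _ _ h.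
Qed.

End MainCriterion.

(** * Simulating bidirected edges by inducing paths *)

Section Simulation.
Variables (V : finType) (K K' : lmg V) (C : {set V}).
Hypothesis qaK : quasi_ancestral K.
Hypothesis undE : und K' = und K.
Hypothesis dirE : dir K' = dir K.
Hypothesis bid_sub : forall x y, bid K x y -> bid K' x y.
Hypothesis bid_new : forall x y, bid K' x y -> bid K x y \/
  ~~ adjacent K x y /\ connect (bid_in K (an K [set x; y])) x y.

Lemma anE' : an K' C = an K C.
Proof. by rewrite /an /ancestor dirE. Qed.

Lemma adj_sub x y : adjacent K x y -> adjacent K' x y.
Proof.
by rewrite /adjacent undE dirE => /or4P[->|/bid_sub->|->|->]; rewrite ?orbT.
Qed.

Lemma arrE' x y : adjacent K x y -> arr K' x y = arr K x y.
Proof.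
rewrite /arr dirE => xy; congr (_ || _); apply/idP/idP; last exact: bid_sub.
by case/bid_new => // -[]; rewrite xy.
Qed.

(** New edges join nonadjacent nodes only, so existing marks do not change. *)
Lemma conn_into_supergraph x y : connecting K C x y -> connecting K' C x y.
Proof.
case=> q h; suff : forall u t, reachw K C x u t q -> reach K' C x u t by apply.
move=> u t; elim=> {u t q h} [t xC|u v t q _ IH uv pt]; first exact: reach0.
rewrite -arrE' in IH; last by rewrite adj_sym.
apply: (reachS IH (adj_sub uv)).
by rewrite /pass anE' arrE'.
Qed.

Lemma go_down x w v t : ancestor K w v -> w \notin an K C -> w != v ->
  reach K C x w false -> pass K C v true t -> reach K C x v t.
Proof.
case/connectP=> p; elim: p w => [|w1 p IH] w /=; first by move=> _ ->; rewrite eqxx.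
case/andP=> d hp e wC wv hw pt.
rewrite -(dir_tail qaK d) in hw.
have adj := arr_adj (dir_arr d).
have [ev|nv] := eqVneq w1 v.
  by subst w1; apply: (reachS hw adj); rewrite dir_arr.
have w1C : w1 \notin an K C by apply: contra wC; exact: anc_an (dir_anc d).
apply: (IH w1) => //; apply: (reachS hw adj).
rewrite /pass andbF; apply: contra w1C; exact: sub_an.
Qed.

Lemma go_up x w u : ancestor K w u -> w \notin an K C ->
  reach K C x u true -> reach K C x w true.
Proof.
case/connectP=> p; elim: p w => [|w1 p IH] w /=; first by move=> _ ->.
case/andP=> d hp e wC hu.
have w1C : w1 \notin an K C by apply: contra wC; exact: anc_an (dir_anc d).
have := IH w1 hp e w1C hu; rewrite -(dir_arr d) => h1.
apply: (reachS h1); first by rewrite adj_sym arr_adj // dir_arr.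
rewrite /pass (dir_tail qaK d) /=; apply: contra wC; exact: sub_an.
Qed.

(** The path is walked along its bidirected edges as long as its nodes are in
    [an C]. Another node is an ancestor of [u] or of [v]: towards [v] the
    directed path leads to the goal, and from [u] the reversed directed path
    leads to the node and replaces the beginning of the walk. *)
Lemma simulate x u v t : u != v -> reach K C x u true ->
  connect (bid_in K (an K [set u; v])) u v -> pass K C v true t -> reach K C x v t.
Proof.
move=> uv hu /connectP[p hp ep] pt.
suff gen w : w != v -> reach K C x w true ->
    path (bid_in K (an K [set u; v])) w p -> v = last w p -> reach K C x v t.
  exact: gen uv hu hp ep.
elim: p w {hp ep uv} => [|w1 p IH] w wv hw /=; first by move=> _ e; rewrite e eqxx in wv.
case/andP=> /and3P[b _ w1S] hp e.
have a1 : arr K w w1 by rewrite /arr b.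
have a2 : arr K w1 w by rewrite /arr bid_sym b.
rewrite -a2 in hw; have st s := reachS (t := s) hw (arr_adj a1).
rewrite a1 in st.
have [ev|nv] := eqVneq w1 v; first by subst w1; exact: st.
have [w1C|w1C] := boolP (w1 \in an K C); first exact: IH w1 nv (st true w1C) hp e.
case/an_pairP: w1S => h; first exact: IH w1 nv (go_up h w1C hu) hp e.
by apply: (go_down h w1C nv (st false _) pt); apply: contra w1C; exact: sub_an.
Qed.

Lemma conn_from_supergraph x y : connecting K' C x y -> connecting K C x y.
Proof.
case=> q h; suff : forall u t, reachw K' C x u t q -> reach K C x u t by apply.
move=> u t; elim=> {u t q h} [t xC|u v t q _ IH uv pt]; first exact: reach0.
have [adj|nadj] := boolP (adjacent K u v).
  rewrite arrE' in IH; last by rewrite adj_sym.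
  by apply: (reachS IH adj); move: pt; rewrite /pass anE' arrE'.
have b : bid K' u v.
  move: uv nadj; rewrite /adjacent undE dirE.
  by case: (und K u v); case: (bid K u v); case: (dir K u v); case: (dir K v u);
    case: (bid K' u v).
case: (bid_new b) => [b'|[_ hc]].
  by rewrite /adjacent b' orbT in nadj.
have uv' : u != v by apply: contraTneq b => ->; rewrite bid_irr.
have a1 : arr K' v u by rewrite /arr bid_sym b.
have a2 : arr K' u v by rewrite /arr b.
rewrite a1 in IH; rewrite a2 in pt.
by apply: simulate uv' IH hc _; move: pt; rewrite /pass anE'.
Qed.

End Simulation.

(** * The completion of an ancestral graph *)

Section Ancestral.
Variables (V : finType) (G : lmg V).

Lemma ancestral_no_arr x y z : ancestral G -> und G x y -> arr G z x = false.
Proof.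
case=> _ _ h3 xy; have [h1 h2 _ _] := h3 _ _ xy z.
by rewrite /arr (negPf h1) (negPf h2).
Qed.

Lemma ancestral_quasi : ancestral G -> quasi_ancestral G.
Proof.
move=> aG; have [h1 h2 h3] := aG; split.
- move=> x y xy; apply/negP => /connectP[p hp e].
  have /negP := h1 (y :: p) isT; apply.
  by rewrite /= rcons_path hp -e.
- by move=> x y /h2[].
- by move=> x y z xy; rewrite (ancestral_no_arr z aG xy).
- by move=> x y z z' xy; rewrite (ancestral_no_arr z aG xy).
Qed.

End Ancestral.

Section Completion.
Variables (V : finType) (G : lmg V).
Hypothesis qaG : quasi_ancestral G.

Lemma bid_in_connect_sym (S : {set V}) x y :
  connect (bid_in G S) x y = connect (bid_in G S) y x.
Proof.
apply: sym_connect_sym => u w.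
by rewrite /bid_in bid_sym; congr (_ && _); rewrite andbC.
Qed.

Lemma inducing_connect x s : inducing G x s -> x != endpoint x s ->
  ~~ adjacent G x (endpoint x s) ->
  connect (bid_in G (an G [set x; endpoint x s])) x (endpoint x s).
Proof.
case/andP=> /(is_pathE qaG)[v [n [-> -> av iv]]]; rewrite endpoint_marked_walk add0n.
move=> /allP hall ne nadj.
have n1 : 1 < n.
  by case: n av nadj ne {iv hall} => [|[|//]] av nadj; rewrite ?eqxx // (av 0) in nadj *.
have hin k : k.+1 < n -> triple_of G (v k) (v k.+1) (v k.+2) \in triples (v 0) (marked_walk G v 0 n).
  by move=> kn; apply/mem_triples; exists k.
apply: inducing_bid => //.
  by move=> k /hin/hall/andP[].
case=> // k kn; have /andP[_ /orP[] h] := hall _ (hin k kn); apply/an_pairP.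
  by left.
by right.
Qed.

Lemma connect_inducing x y : connect (bid_in G (an G [set x; y])) x y ->
  exists2 s, inducing G x s & endpoint x s = y.
Proof.
case/connectP=> p hp; case: (shortenP hp) => {hp}p hp up _ e.
pose s : seq (marks * V) := [seq ((true, true), z) | z <- p].
have us : unzip2 s = p by rewrite /unzip2 -map_comp map_id.
exists s; last by rewrite /endpoint us.
rewrite /inducing /is_path /nodes us up /endpoint us -e /=.
move: hp; set S := an G _; rewrite /s; clear -x.
suff h : forall z, path (bid_in G S) z p ->
    joined G z [seq ((true, true), z) | z <- p] &&
    all (fun T => collider T && (mid T \in S))
      (triples z [seq ((true, true), z) | z <- p]).
  move=> /h/andP[-> /=]; apply: sub_all => T /andP[-> /an_pairP[]] -> //=; by rewrite orbT.
elim: p => [|w p IH] z //= /andP[/and3P[b _ wS] hp].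
have /andP[j a] := IH w hp.
rewrite b j /=; case: p {IH j hp} a => //= w' p a.
by rewrite wS.
Qed.

Definition linked x y := inducing_nonadjacent G x y || inducing_nonadjacent G y x.

Lemma linkedP x y : reflect [/\ x != y, ~~ adjacent G x y
    & connect (bid_in G (an G [set x; y])) x y] (linked x y).
Proof.
apply: (iffP orP).
  have h u w : inducing_nonadjacent G u w -> [/\ u != w, ~~ adjacent G u w
      & connect (bid_in G (an G [set u; w])) u w].
    case/and3P=> uw nadj /asboolP[s hs e]; split=> //.
    by have := inducing_connect hs; rewrite e; apply.
  case=> /h // [h1 h2 h3]; split; rewrite 1?eq_sym 1?adj_sym //.
  by rewrite setUC bid_in_connect_sym.
case=> xy nadj hc; left; apply/and3P; split=> //.
by apply/asboolP; exact: connect_inducing.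
Qed.

Lemma linked_sym x y : linked x y = linked y x.
Proof. by rewrite /linked orbC. Qed.

Lemma linked_bid x y : linked x y -> exists w, bid G x w.
Proof.
case/linkedP=> xy _ /connectP[[|w p]]; first by move=> _ /= e; rewrite e eqxx in xy.
by case/andP=> /and3P[b _ _] _ _; exists w.
Qed.

(** Otherwise all nodes of the inducing path would be ancestors of [y], against
    the arrowhead at its last inner node. *)
Lemma linked_anc x y : linked x y -> ~~ ancestor G x y.
Proof.
rewrite linked_sym => /linkedP[xy _ /connectP[[|w p]]].
  by move=> _ /= e; rewrite e eqxx in xy.
case/andP=> /and3P[b _ wS] _ _; apply/negP => h.
have : ancestor G w y by case/an_pairP: wS => // /anc_trans; apply.
by apply/negP; apply: arr_anc => //; rewrite /arr b.
Qed.

Lemma completion_bidE x y : bid (completion G) x y = bid G x y || linked x y.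
Proof. by []. Qed.

Lemma adj_completion x y : adjacent (completion G) x y = adjacent G x y || linked x y.
Proof.
rewrite /adjacent completion_bidE /=.
by case: (und G x y); case: (bid G x y); case: (linked x y); rewrite /= ?orbT ?orbF.
Qed.

(** Each new edge on an inducing path expands to an inducing path of [G] whose
    nodes are ancestors of the same two ends. *)
Lemma completion_maximal : maximal (completion G).
Proof.
move=> x y xy; rewrite adj_completion => /norP[nadj /linkedP nl].
apply/negP => hc; apply: nl; split=> //.
apply: connect_sub hc => u w /and3P[]; rewrite completion_bidE.
case/orP=> [b uS wS|/linkedP[_ _ h] uS wS].
  by apply: connect1; apply/and3P.
apply: connect_sub h => u' w' /and3P[b u'S w'S]; apply: connect1.
have sub z : z \in an G [set u; w] -> z \in an G [set x; y].
  by case/an_pairP => h; [exact: anc_an h uS | exact: anc_an h wS].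
  by rewrite /bid_in b !sub.
Qed.

End Completion.

Lemma completion_ancestral (V : finType) (G : lmg V) :
  ancestral G -> ancestral (completion G).
Proof.
move=> aG; have [h1 h2 h3] := aG; have qaG := ancestral_quasi aG.
split=> //.
- move=> i j; rewrite completion_bidE => /orP[/h2//|l].
  split; first exact: linked_anc l.
  by rewrite linked_sym in l; exact: linked_anc l.
- move=> i j ij k; have [-> b1 -> b2] := h3 i j ij k.
  have no u w : und G u w -> ~~ linked G k u.
    move=> uw; apply/negP; rewrite linked_sym => /(linked_bid qaG)[z].
    by have [_ + _ _] := h3 u w uw z; rewrite bid_sym => /negPf->.
  rewrite !completion_bidE (negPf b1) (negPf b2) (negPf (no _ _ ij)).
  by rewrite (negPf (no j i _)) // und_sym.
Qed.

(** * Intervention nodes *)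

Section Aug.
Variables (p m : nat) (I : 'I_m -> {set 'I_p}).

(** No edge of an augmented graph points to an intervention node. *)
Lemma connect_inl (e : rel (inode I)) (e0 : rel 'I_p) :
  (forall i j, e (inl i) (inl j) = e0 i j) -> (forall i w, ~~ e (inl i) (inr w)) ->
  forall i z, connect e (inl i) z = if z is inl j then connect e0 i j else false.
Proof.
move=> h1 h2 i z; apply/idP/idP.
  case/connectP=> q; elim: q i => [|[j|w] q IH] i /=.
  - by move=> _ ->; exact: connect0.
  - case/andP; rewrite h1 => ij /IH hq /hq {hq}; case: z {IH} => // k.
    exact: connect_trans (connect1 ij).
  - by rewrite (negPf (h2 _ _)).
case: z => // j /connectP[q]; elim: q i => [|k q IH] i /=.
  by move=> _ ->; exact: connect0.
case/andP; rewrite -h1 => ik /IH hq /hq; exact: connect_trans (connect1 ik).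
Qed.

Section One.
Variable G : lmg 'I_p.
Notation A := (aug I G).

Lemma anc_aug i z : ancestor A (inl i) z = if z is inl j then ancestor G i j else false.
Proof. exact: connect_inl. Qed.

Lemma arr_inr x w : arr A x (inr w) = false.
Proof. by case: x. Qed.

Lemma arr_inl i j : arr A (inl i) (inl j) = arr G i j.
Proof. by []. Qed.

Lemma source_inr w : source A (inr w).
Proof. by apply/forallP => -[i|w']. Qed.

Lemma adj_inl i j : adjacent A (inl i) (inl j) = adjacent G i j.
Proof. by []. Qed.

Lemma an_aug_pair i j k :
  (inl k \in an A [set inl i; inl j]) = (k \in an G [set i; j]).
Proof. by apply/an_pairP/an_pairP; rewrite !anc_aug. Qed.

Lemma connect_bid_in_aug i j z : connect (bid_in A (an A [set inl i; inl j])) (inl i) z =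
  if z is inl k then connect (bid_in G (an G [set i; j])) i k else false.
Proof.
apply: connect_inl => // k l.
by rewrite /bid_in !an_aug_pair.
Qed.

(** Two arrowheads at a node with an undirected edge come from distinct
    intervention nodes, which then doubly intervene on it. *)
Lemma aug_quasi : ancestral G ->
  (forall i, selection_adjacent G i -> ~ doubly_intervenes I i) ->
  quasi_ancestral A.
Proof.
move=> aG hI; have qa := ancestral_quasi aG.
have no i j k : und G i j -> arr A (inl k) (inl i) = false.
  exact: ancestral_no_arr.
split.
- case=> [i|w] [j|w'] //=; first by rewrite anc_aug; exact: qa_dir.
  by rewrite anc_aug.
- by case=> [i|w] [j|w'] //=; rewrite anc_aug; exact: qa_bid.
- case=> [i|w] [j|w'] [k|w''] //= u; first by rewrite (no i j k u).
  by move=> _; exact: source_inr.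
- case=> [i|w] [j|w'] //= z z' u.
  case: z => [k|w]; first by rewrite (no i j k u).
  case: z' => [k|w']; first by move=> _; rewrite (no i j k u).
  rewrite /arr /= => hw hw'; have [->//|ne] := eqVneq w w'.
  case: (hI i); first by apply/existsP; exists j.
  by exists (val w), (val w'); split=> //; rewrite inE hw.
Qed.

Lemma aug_maximal : maximal G -> maximal A.
Proof.
move=> mG x y xy nadj; apply/negP => hc.
case: x xy nadj hc => [i|w] xy nadj.
  case: y xy nadj => [j|w] xy nadj; rewrite ?connect_bid_in_aug //.
    by apply/negP; apply: mG nadj; apply: contraNneq xy => ->.
  case/connectP=> q; case/lastP: q => // q u; rewrite rcons_path last_rcons.
  by move=> /andP[_ /and3P[+ _ _]] e; rewrite -e /=; case: (last _ _).
by case/connectP=> -[_ e|u q]; [rewrite e eqxx in xy | case/andP=> /and3P[]].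
Qed.

Lemma ordered_aug i j k : ordered G i j k -> ordered A (inl i) (inl j) (inl k).
Proof.
elim=> {i j k} [v n c dv _ IH|i j k _]; last exact: ordered_sym.
apply: (@ordered_disc _ A (fun k => inl (v k))) => //.
case: dv => h1 h2 h3 h4 h5 h6 h7; split=> //.
by move=> i j hi hj [e]; exact: h3.
Qed.

(** The boolean decides on all intervention nodes at once. *)
Definition lift_set (b : bool) (C : {set 'I_p}) : {set inode I} :=
  [set z | if z is inl i then i \in C else b].

Lemma in_lift b C i : (inl i \in lift_set b C) = (i \in C).
Proof. by rewrite inE. Qed.

Lemma an_lift C i : (inl i \in an A (lift_set true C)) = (i \in an G C).
Proof.
apply/mem_an/mem_an => -[c].
  by case: c => [c|w]; rewrite inE => cC; rewrite anc_aug // => h; exists c.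
by move=> cC h; exists (inl c); rewrite ?inE ?anc_aug.
Qed.

(** An intervention node is never a collider, so conditioning on it confines
    walks to the original nodes. *)
Lemma connecting_lift C i j :
  connecting A (lift_set true C) (inl i) (inl j) <-> connecting G C i j.
Proof.
have ps k s t : pass A (lift_set true C) (inl k) s t = pass G C k s t.
  by rewrite /pass an_lift in_lift.
split=> -[q h].
  suff : forall z t, reachw A (lift_set true C) (inl i) z t q ->
      exists2 k, z = inl k & reach G C i k t.
    by move=> /(_ _ _ h)[k [->]].
  move=> z t; elim=> {z t q h} [t|z z' t q _ IH adj pt].
    by rewrite inE => iC; exists i => //; exact: reach0.
  case: z' adj pt IH => [k|w] adj pt [l e hl]; subst z.
    by exists k => //; apply: (reachS hl adj); rewrite -ps.
  by move: pt; rewrite /pass arr_inr /= inE.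
suff : forall k t, reachw G C i k t q -> reach A (lift_set true C) (inl i) (inl k) t.
  by apply.
move=> k t; elim=> {k t q h} [t iC|k l t q _ IH adj pt].
  by apply: reach0; rewrite inE.
rewrite -arr_inl -adj_inl -ps in IH adj pt.
exact: reachS IH adj pt.
Qed.

End One.

Lemma lift_disjoint b (B C : {set 'I_p}) : [disjoint B & C] ->
  [disjoint lift_set false B & lift_set b C].
Proof.
rewrite -!setI_eq0 => /eqP/setP h; apply/eqP/setP => -[i|w]; rewrite !inE //.
by have := h i; rewrite !inE.
Qed.

Lemma aug_markov_plain (G H : lmg 'I_p) :
  quasi_ancestral G -> quasi_ancestral (aug I G) ->
  quasi_ancestral H -> quasi_ancestral (aug I H) ->
  markov_equiv (aug I G) (aug I H) -> markov_equiv G H.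
Proof.
suff h (G' H' : lmg 'I_p) :
  quasi_ancestral G' -> quasi_ancestral (aug I G') ->
  quasi_ancestral H' -> quasi_ancestral (aug I H') ->
  markov_equiv (aug I G') (aug I H') -> forall A B C, indep_model G' A B C -> indep_model H' A B C.
  move=> q1 q2 q3 q4 me A B C; split; first exact: h.
  by apply: h => //; exact: markov_equiv_sym.
move=> q1 q2 q3 q4 me A B C /(indep_conn q1)[h1 h2 h3 h4].
have : indep_model (aug I G') (lift_set false A) (lift_set false B) (lift_set true C).
  apply/(indep_conn q2); split; try exact: lift_disjoint.
  case=> [i|w] [j|w']; rewrite !inE // => iA jB /connecting_lift; exact: h4.
case/me/(indep_conn q4)=> _ _ _ h5; apply/(indep_conn q3); split=> //.
by move=> x y xA yB /connecting_lift; apply: h5; rewrite inE.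
Qed.

Lemma aug_completion_conn (G : lmg 'I_p) (C : {set inode I}) x y :
  quasi_ancestral G -> quasi_ancestral (aug I G) ->
  connecting (aug I (completion G)) C x y <-> connecting (aug I G) C x y.
Proof.
move=> qa qaA.
have sub u w : bid (aug I G) u w -> bid (aug I (completion G)) u w.
  by case: u w => [i|?] [j|?] //=; rewrite /completion_bid => ->.
have new u w : bid (aug I (completion G)) u w -> bid (aug I G) u w \/
    ~~ adjacent (aug I G) u w /\
    connect (bid_in (aug I G) (an (aug I G) [set u; w])) u w.
  case: u w => [i|?] [j|?] //= /orP[|/(linkedP qa)[_ nadj hc]]; first by left.
  by right; split=> //; rewrite connect_bid_in_aug.
have undE : und (aug I (completion G)) = und (aug I G) by [].
have dirE : dir (aug I (completion G)) = dir (aug I G) by [].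
split; first exact: (conn_from_supergraph qaA undE dirE sub new).
exact: (conn_into_supergraph undE dirE sub new).
Qed.

Lemma aug_completion_markov (G : lmg 'I_p) A B C :
  ancestral G -> (forall i, selection_adjacent G i -> ~ doubly_intervenes I i) ->
  indep_model (aug I G) A B C <-> indep_model (aug I (completion G)) A B C.
Proof.
move=> aG hI; have qa := ancestral_quasi aG; have qA := aug_quasi aG hI.
have qA' := aug_quasi (completion_ancestral aG) hI.
rewrite !indep_conn //; split=> -[h1 h2 h3 h4]; split=> // x y xA yB h.
  by apply: (h4 x y xA yB); apply/aug_completion_conn.
by apply: (h4 x y xA yB); apply/aug_completion_conn.
Qed.

(** Colliders with order of the plain graph remain such after augmentation. *)
Lemma I_colliderE (G H : lmg 'I_p) :
  quasi_ancestral G -> quasi_ancestral (aug I G) ->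
  quasi_ancestral H -> quasi_ancestral (aug I H) ->
  (forall i j k, collider_with_order G i j k <-> collider_with_order H i j k) ->
  (forall x y z, I_collider_with_order (I := I) G x y z <-> I_collider_with_order (I := I) H x y z) <->
  (forall x y z, collider_with_order (aug I G) x y z <-> collider_with_order (aug I H) x y z).
Proof.
move=> q1 q2 q3 q4 h.
pose old (K : lmg 'I_p) (x y z : inode I) := exists i j k, [/\ x = inl i, y = inl j, z = inl k
                     & collider_with_order K i j k].
have oldE x y z : old G x y z <-> old H x y z.
  by split=> -[i [j [k [-> -> -> /h c]]]]; exists i, j, k.
have sub (K : lmg 'I_p) : quasi_ancestral K -> quasi_ancestral (aug I K) ->
    forall x y z, old K x y z -> collider_with_order (aug I K) x y z.
  move=> qK qA x y z [i [j [k [-> -> -> /(collider_with_orderE qK)[c o]]]]].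
  by apply/(collider_with_orderE qA); split=> //; exact: ordered_aug.
split=> hc x y z; have := oldE x y z; have := hc x y z; rewrite /I_collider_with_order -!/(old _ x y z).
  move=> hi ho; have [o|no] := pselect (old G x y z).
    by split=> _; apply: sub => //; apply/ho.
  have no' : ~ old H x y z by move/ho.
  split=> c.
    by have /hi[] : collider_with_order (aug I G) x y z /\ ~ old G x y z by [].
  by have /hi[] : collider_with_order (aug I H) x y z /\ ~ old H x y z by [].
by move=> hi ho; rewrite hi ho.
Qed.

End Aug.

Theorem theorem2 (p m : nat) (G H : lmg 'I_p) (I : 'I_m -> {set 'I_p})
    (hG : ancestral G) (hH : ancestral H)
    (hI : forall i : 'I_p, selection_adjacent G i \/ selection_adjacent H i ->
            ~ doubly_intervenes I i) :
  (I_markov_equiv I G H <->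
     I_markov_equiv I (completion G) (completion H)) /\
  (I_markov_equiv I (completion G) (completion H) <->
     markov_equiv (completion G) (completion H) /\
     (forall x y z : inode I,
        I_collider_with_order (completion G) x y z <->
        I_collider_with_order (completion H) x y z)).
Proof.
have hIG i : selection_adjacent G i -> ~ doubly_intervenes I i by move=> h; apply: hI; left.
have hIH i : selection_adjacent H i -> ~ doubly_intervenes I i by move=> h; apply: hI; right.
split.
  split=> me A B C; have eG := aug_completion_markov A B C hG hIG;
    have eH := aug_completion_markov A B C hH hIH;
    by split=> [/eG/me/eH|/eH/me/eG].
have aG := completion_ancestral hG; have aH := completion_ancestral hH.
have qG := ancestral_quasi aG; have qH := ancestral_quasi aH.
have mG := completion_maximal (ancestral_quasi hG).
have mH := completion_maximal (ancestral_quasi hH).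
have qAG : quasi_ancestral (aug I (completion G)) := aug_quasi aG hIG.
have qAH : quasi_ancestral (aug I (completion H)) := aug_quasi aH hIH.
have mAG := aug_maximal (I := I) mG; have mAH := aug_maximal (I := I) mH.
split.
  move=> me; have me0 := aug_markov_plain qG qAG qH qAH me; split=> //.
  apply/(I_colliderE qG qAG qH qAH); first exact: markov_colliders.
  exact: markov_colliders.
case=> me0 hc; apply: colliders_markov => //.
  have e := markov_eq_adj qG qH mG mH me0.
  by case=> [i|w] [j|w'] //; exact: e.
by apply/(I_colliderE qG qAG qH qAH) => //; exact: markov_colliders.
Qed.
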